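(* Let $\mathcal B$ be a combinatorial triangulated closed disk (finitely many triangles) and let a positive number $\ell_{ij}$ be assigned to each edge $V_iV_j$ of the triangulation. Then the edge lengths $\ell_{ij}$ can be nondegenerately developed in the Euclidean plane (in the sense defined in the context) if and only if both of the following hold: (a) for every triangle of the triangulation and every labelling $V_i,V_j,V_k$ of its vertices, the strict triangle inequality $\ell_{ik}<\ell_{ij}+\ell_{jk}$ holds; (b) $K(V_i)=0$ for every interior vertex $V_i$ of $\mathcal B$. Moreover, the development is unique up to a rigid motion or reflection of the plane.
   Context: A nondegenerate development of $(\mathcal B,\ell)$ is a continuous map $\phi:\mathcal B\to\mathbf E^2$ that is affine and injective on each triangle, is locally injective at every interior point of $\mathcal B$ (a piecewise-linear immersion; globally the image may overlap itself), and satisfies $|\phi(V_i)-\phi(V_j)|=\ell_{ij}$ for every edge $V_iV_j$. Equivalently, triangles of the prescribed side lengths are laid out in the plane triangle by triangle, like a jigsaw puzzle. Curvature atom: if $V_i$ is an interior vertex and $V_{i_1},\dots,V_{i_k}$ are its adjacent vertices in cyclic order ($V_{i_{k+1}}=V_{i_1}$), then $$K(V_i)=\sum_{j=1}^k\angle(V_{i_j},V_i,V_{i_{j+1}})-2\pi ,$$ where the angles are computed from the edge lengths by the cosine law, $$\angle(A,B,C)=\cos^{-1}\!\left(\frac{\ell_{AB}^2+\ell_{BC}^2-\ell_{AC}^2}{2\ell_{AB}\ell_{BC}}\right).$$ *)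

(* Defs.v *)
From HB Require Import structures.
From mathcomp Require Import all_boot all_order all_algebra.
From mathcomp Require Import all_classical all_reals.
From mathcomp Require Import topology normedtype trigo.
Set Implicit Arguments.
Unset Strict Implicit.
Unset Printing Implicit Defensive.
Import Order.TTheory GRing.Theory Num.Theory.
Import numFieldNormedType.Exports.
Local Open Scope ring_scope.

(** A finite triangulation has vertex set ['I_n] and is given by its set [T] of
    triangles, each triangle being the set of its three vertices. *)
Section Combinatorics.
Variable n : nat.
Implicit Types (T : {set {set 'I_n}}) (i j a b v : 'I_n) (c p : seq 'I_n).

Definition edges T : {set {set 'I_n}} :=
  [set e : {set 'I_n} | (#|e| == 2) && [exists t in T, e \subset t]]%SET.

Definition boundary_edges T : {set {set 'I_n}} :=
  [set e in edges T | #|[set t in T | e \subset t]| == 1]%SET.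

Definition interior_vertex T v : bool :=
  [forall e in boundary_edges T, v \notin e].

(** The link of [v], as a graph on the vertices.  When all members of [T] have
    cardinal 3, [link T v a b] forces [v], [a], [b] to be distinct. *)
Definition link T v : rel 'I_n := fun a b => [set v; a; b]%SET \in T.

(** [c] lists the vertices adjacent to [v] in cyclic order: the link of [v] is
    exactly the cycle [c]. *)
Definition cyclic_link T v c : Prop :=
  [/\ uniq c, (2 < size c)%N &
      forall a b, link T v a b = (a \in c) && ((b == next c a) || (b == prev c a))].

Definition path_link T v p : Prop :=
  [/\ uniq p, (1 < size p)%N &
      forall a b, link T v a b = infix [:: a; b] p || infix [:: b; a] p].

(** Possibly disconnected combinatorial surface with boundary. *)
Definition combinatorial_surface T : Prop :=
  (forall t, t \in T -> #|t| = 3) /\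
  (forall v, (exists c, cyclic_link T v c) \/ (exists p, path_link T v p)).

End Combinatorics.

Local Open Scope classical_set_scope.

Section Geometry.
Variable R : realType.

(** The norm of the library on ['rV[R]_2] is the sup norm, hence this explicit
    Euclidean distance; both induce the same topology. *)
Definition edist (x y : 'rV[R]_2) : R :=
  Num.sqrt (\sum_(k < 2) (x 0 k - y 0 k) ^+ 2).

Definition closed_unit_disk : set 'rV[R]_2 := [set x : 'rV[R]_2 | edist x 0 <= 1].

Definition homeomorphic (n m : nat) (A : set 'rV[R]_n) (B : set 'rV[R]_m) : Prop :=
  exists (f : 'rV[R]_n -> 'rV[R]_m) (g : 'rV[R]_m -> 'rV[R]_n),
    [/\ {within A, continuous f}, {within B, continuous g},
        (forall x, A x -> B (f x) /\ g (f x) = x) &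
        (forall y, B y -> A (g y) /\ f (g y) = y)].

Section Development.
Variable n : nat.
Implicit Types (T : {set {set 'I_n}}) (l : {set 'I_n} -> R).

(** Points of the geometric realization are given by barycentric coordinates;
    the vertex [i] is the point [delta_mx 0 i]. *)
Definition simplex (s : {set 'I_n}) : set 'rV[R]_n :=
  [set x : 'rV[R]_n | [/\ forall i, 0 <= x 0 i, forall i, i \notin s -> x 0 i = 0 &
               \sum_i x 0 i = 1]].

Definition vertex (i : 'I_n) : 'rV[R]_n := delta_mx 0 i.

Definition realization T : set 'rV[R]_n :=
  \bigcup_(t in [set t | t \in T]) simplex t.

Definition boundary T : set 'rV[R]_n :=
  \bigcup_(e in [set e | e \in boundary_edges T]) simplex e.

Definition triangulated_disk T : Prop :=
  combinatorial_surface T /\ homeomorphic (realization T) closed_unit_disk.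

(** [angle l A B C] is the angle at [B]; [l] gives the length of an edge as a
    function of its set of endpoints. *)
Definition angle l (A B C : 'I_n) : R :=
  acos ((l [set A; B]%SET ^+ 2 + l [set B; C]%SET ^+ 2 - l [set A; C]%SET ^+ 2)
        / (2 * l [set A; B]%SET * l [set B; C]%SET)).

(** [c] is meant to be the cyclic list of the vertices adjacent to [v]. *)
Definition curvature l (v : 'I_n) (c : seq 'I_n) : R :=
  \sum_(a <- c) angle l a v (next c a) - 2 * pi.

Definition affine_on (A : set 'rV[R]_n) (phi : 'rV[R]_n -> 'rV[R]_2) : Prop :=
  forall (x y : 'rV[R]_n) (t : R), A x -> A y -> 0 <= t <= 1 ->
    phi (t *: x + (1 - t) *: y) = t *: phi x + (1 - t) *: phi y.

(** Only the values of [phi] on [realization T] are relevant. *)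
Definition nondegenerate_development T l (phi : 'rV[R]_n -> 'rV[R]_2) : Prop :=
  [/\ {within realization T, continuous phi},
      (forall t, t \in T -> affine_on (simplex t) phi /\ set_inj (simplex t) phi),
      (forall x, (realization T `\` boundary T) x ->
         exists2 U, nbhs x U & set_inj (realization T `&` U) phi) &
      (forall i j, [set i; j]%SET \in edges T ->
         edist (phi (vertex i)) (phi (vertex j)) = l [set i; j]%SET)].

End Development.

(** [x |-> x *m M + b] with [M] orthogonal is a rigid motion if [\det M = 1],
    and a reflection followed by a rigid motion if [\det M = -1]. *)
Definition congruent_on n (A : set 'rV[R]_n) (phi psi : 'rV[R]_n -> 'rV[R]_2) : Prop :=
  exists (M : 'M[R]_2) (b : 'rV[R]_2),
    M *m M^T = 1%:M /\ forall x, A x -> psi x = phi x *m M + b.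

End Geometry.

(* Main.v *)
Require Import Defs.
From HB Require Import structures.
From mathcomp Require Import all_boot all_order all_algebra.
From mathcomp Require Import zify ring lra.
From mathcomp Require Import all_classical all_reals.
From mathcomp Require Import topology normedtype trigo.
(* Imported again because [topology] also defines an [edist]. *)
Import Defs.
Set Implicit Arguments.
Unset Strict Implicit.
Unset Printing Implicit Defensive.
Import Order.TTheory GRing.Theory Num.Theory.
Import numFieldNormedType.Exports.
Local Open Scope ring_scope.

(** In terms of the positions [P] of the vertices, a development is the
    piecewise affine extension of a placement: every triangle gets its prescribed
    lengths, and two triangles sharing an edge lie on either side of it.

    The triangles around a vertex can be laid out one after the other, the
    directions of the edges being the partial sums of the angles.  Around an
    interior vertex this closes up and is injective exactly when the angles add
    up to [2 pi]: closing up makes the sum a multiple of [2 pi], and from [4 pi] on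
    two of the sectors overlap.

    The placements of the star of a vertex form a torsor under the isometries of
    the plane, and those of adjacent stars are related by a unique isometry.  This
    local system on the triangulated disk has trivial monodromy, as one sees by
    transporting along the rays from the centre of the disk; a global section is a
    placement.  The rigidity of stars also gives uniqueness. *)

(** * Plane geometry *)

Section Plane.
Variable R : realType.
Implicit Types u w x y : 'rV[R]_2.

(** The disk is given only by a homeomorphism, with no ordering of its triangles such as a shelling,
    so the triangles are not laid down by induction. Topology enters through a Lebesgue number: each
    point of the disk is assigned a vertex with a large barycentric coordinate, and uniform
    continuity of the inverse homeomorphism gives close points vertices of a common triangle.
    Transport becomes a finite composition of transition maps, and its invariance under small moves
    becomes the commutation of small squares, each checked inside one triangle. No orientation is
    chosen. Sides are compared by the sign of a product of two [cross] values, which reflections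
    preserve, so the structure group is the full isometry group. The direction angles are partial
    sums in [R], not residues modulo [2 pi]: closing up only sees the cosine of the total, while
    injectivity has to tell [2 pi] from its larger multiples. *)

Definition cross u w : R := u 0 0 * w 0 1 - u 0 1 * w 0 0.
Definition dot u w : R := u 0 0 * w 0 0 + u 0 1 * w 0 1.

Lemma ord2P (k : 'I_2) : k = 0 \/ k = 1.
Proof. by case: k => [[|[|//]]] h; [left|right]; apply/val_inj. Qed.

Lemma row2P u w : u 0 0 = w 0 0 -> u 0 1 = w 0 1 -> u = w.
Proof.
move=> e0 e1; apply/matrixP => i k; rewrite ord1.
by case: (ord2P k) => ->.
Qed.

Lemma sum2 (F : 'I_2 -> R) : \sum_(k < 2) F k = F 0 + F 1.
Proof. by rewrite big_ord_recl big_ord1; congr (F _ + F _); apply/val_inj. Qed.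

Lemma edistE x y : edist x y = Num.sqrt (dot (x - y) (x - y)).
Proof. by rewrite /edist sum2 /dot !mxE !expr2. Qed.

Lemma dot_ge0 u : 0 <= dot u u.
Proof. by rewrite /dot -!expr2 addr_ge0 ?sqr_ge0. Qed.

Lemma edist_ge0 x y : 0 <= edist x y.
Proof. exact: sqrtr_ge0. Qed.

Lemma sqr_edist x y : edist x y ^+ 2 = dot (x - y) (x - y).
Proof. by rewrite edistE sqr_sqrtr ?dot_ge0. Qed.

Lemma edistC x y : edist x y = edist y x.
Proof. by rewrite !edistE; congr Num.sqrt; rewrite /dot !mxE; ring. Qed.

Lemma eq_edist x y x' y' : dot (x - y) (x - y) = dot (x' - y') (x' - y') ->
  edist x y = edist x' y'.
Proof. by rewrite !edistE => ->. Qed.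

Lemma lagrange u w : dot u w ^+ 2 + cross u w ^+ 2 = dot u u * dot w w.
Proof. by rewrite /dot /cross; ring. Qed.

Lemma crossC u w : cross w u = - cross u w.
Proof. by rewrite /cross; ring. Qed.

Lemma cross_rebase x y z : cross (x - y) (z - y) = - cross (y - x) (z - x).
Proof. by rewrite /cross !mxE; ring. Qed.

Lemma dot0_eq0 u : dot u u = 0 -> u = 0.
Proof.
move=> /eqP; rewrite /dot -!expr2 paddr_eq0 ?sqr_ge0 // !sqrf_eq0.
by move=> /andP[/eqP u0 /eqP u1]; apply: row2P; rewrite mxE.
Qed.

Lemma dot_polar x y z :
  dot (y - x) (z - x) = (edist x y ^+ 2 + edist x z ^+ 2 - edist y z ^+ 2) / 2.
Proof. by rewrite !sqr_edist /dot !mxE; field. Qed.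

(** [u] and its quarter turn form an orthogonal basis, in which [dot] and [cross] are the
    coordinates up to the factor [dot u u]. *)
Lemma eq_from_dot_cross u w w' : u != 0 ->
  dot u w = dot u w' -> cross u w = cross u w' -> w = w'.
Proof.
move=> u0 d c; have dn : dot u u != 0 by apply: contraNneq u0 => /dot0_eq0 ->.
have e0 : w 0 0 * dot u u = u 0 0 * dot u w - u 0 1 * cross u w.
  by rewrite /dot /cross; ring.
have e0' : w' 0 0 * dot u u = u 0 0 * dot u w' - u 0 1 * cross u w'.
  by rewrite /dot /cross; ring.
have e1 : w 0 1 * dot u u = u 0 1 * dot u w + u 0 0 * cross u w.
  by rewrite /dot /cross; ring.
have e1' : w' 0 1 * dot u u = u 0 1 * dot u w' + u 0 0 * cross u w'.
  by rewrite /dot /cross; ring.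
by apply: row2P; apply: (mulIf dn); rewrite ?e0 ?e0' ?e1 ?e1' d c.
Qed.

(** The distances fix the dot product and, by the Lagrange identity, the square of the cross
    product; lying on the same side of the line [x y] excludes the mirror image. *)
Lemma third_point x y z z' :
  edist x z = edist x z' -> edist y z = edist y z' ->
  0 < cross (y - x) (z - x) * cross (y - x) (z' - x) -> z = z'.
Proof.
move=> xz yz cc; apply: (addIr (- x)).
have d : dot (y - x) (z - x) = dot (y - x) (z' - x) by rewrite !dot_polar xz yz.
have d2 : dot (z - x) (z - x) = dot (z' - x) (z' - x).
  by rewrite -!sqr_edist ![edist _ x]edistC xz.
apply: (@eq_from_dot_cross (y - x)) => //.
  by apply: contraTneq cc => ->; rewrite /cross !mxE; lra.
have : cross (y - x) (z - x) ^+ 2 = cross (y - x) (z' - x) ^+ 2.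
  by apply: (@addrI _ (dot (y - x) (z - x) ^+ 2)); rewrite lagrange d2 -lagrange d.
move/eqP; rewrite eqf_sqr => /orP[/eqP//|/eqP e]; move: cc.
by rewrite e mulNr oppr_gt0 ltNge -expr2 sqr_ge0.
Qed.

Definition isom (f : 'rV[R]_2 -> 'rV[R]_2) : Prop :=
  exists (M : 'M[R]_2) (b : 'rV[R]_2), M *m M^T = 1%:M /\ forall x, f x = x *m M + b.

Lemma isom_id : isom id.
Proof.
by exists 1%:M, 0; split=> [|x]; rewrite ?trmx1 mulmx1 // addr0.
Qed.

Lemma isom_comp f g : isom f -> isom g -> isom (f \o g).
Proof.
move=> [M [b [MM fE]]] [N [c [NN gE]]]; exists (N *m M), (c *m M + b).
split=> [|x /=]; first by rewrite trmx_mul mulmxA -(mulmxA N) MM mulmx1.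
by rewrite fE gE mulmxDl mulmxA addrA.
Qed.

Lemma isom_inv f : isom f -> exists2 g, isom g & cancel f g.
Proof.
move=> [M [b [MM fE]]]; exists (fun x => (x - b) *m M^T).
  exists M^T, (- b *m M^T); split=> [|x]; last by rewrite mulmxBl mulNmx.
  by rewrite trmxK; exact: mulmx1C.
by move=> x; rewrite fE addrK -mulmxA MM mulmx1.
Qed.

Lemma isom_inj f : isom f -> injective f.
Proof. by move=> /isom_inv[g _]; exact: can_inj. Qed.

Lemma mul2mxE u (M : 'M[R]_2) k : (u *m M) 0 k = u 0 0 * M 0 k + u 0 1 * M 1 k.
Proof. by rewrite mxE sum2. Qed.

Lemma orthP (M : 'M[R]_2) : M *m M^T = 1%:M ->
  [/\ M 0 0 ^+ 2 + M 0 1 ^+ 2 = 1, M 1 0 ^+ 2 + M 1 1 ^+ 2 = 1 &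
      M 0 0 * M 1 0 + M 0 1 * M 1 1 = 0].
Proof.
move=> /matrixP MM.
by split; [move: (MM 0 0)|move: (MM 1 1)|move: (MM 0 1)];
  rewrite !mxE sum2 !mxE // !expr2.
Qed.

Lemma isom_dot f x y z : isom f ->
  dot (f y - f x) (f z - f x) = dot (y - x) (z - x).
Proof.
move=> [M [b [/orthP[m0 m1 m01] fE]]].
rewrite /dot !fE !mxE !sum2.
set p := y 0 0; set q := y 0 1; set r := x 0 0; set s := x 0 1.
set t := z 0 0; set v := z 0 1.
transitivity ((p - r) * (t - r) * (M 0 0 ^+ 2 + M 0 1 ^+ 2) +
  (q - s) * (v - s) * (M 1 0 ^+ 2 + M 1 1 ^+ 2) +
  ((p - r) * (v - s) + (q - s) * (t - r)) * (M 0 0 * M 1 0 + M 0 1 * M 1 1)).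
  by ring.
by rewrite m0 m1 m01; ring.
Qed.

Lemma isom_edist f x y : isom f -> edist (f x) (f y) = edist x y.
Proof. by move=> fi; apply: eq_edist; rewrite isom_dot. Qed.

(** The factor [e] is the determinant of the linear part. Its sign cancels in the products of two
    crosses by which sides are compared. *)
Lemma isom_cross f : isom f -> exists2 e : R, e ^+ 2 = 1 &
  forall x y z, cross (f y - f x) (f z - f x) = e * cross (y - x) (z - x).
Proof.
move=> [M [b [/orthP[m0 m1 m01] fE]]].
exists (M 0 0 * M 1 1 - M 0 1 * M 1 0); last first.
  by move=> x y z; rewrite /cross !fE !mxE !sum2; ring.
transitivity ((M 0 0 ^+ 2 + M 0 1 ^+ 2) * (M 1 0 ^+ 2 + M 1 1 ^+ 2) -
  (M 0 0 * M 1 0 + M 0 1 * M 1 1) ^+ 2); first by ring.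
by rewrite m0 m1 m01; ring.
Qed.

Lemma isom_side f x y z z' : isom f ->
  cross (f y - f x) (f z - f x) * cross (f y - f x) (f z' - f x) =
  cross (y - x) (z - x) * cross (y - x) (z' - x).
Proof.
move=> /isom_cross[e e2 fE]; rewrite !fE.
by rewrite mulrACA -expr2 e2 mul1r.
Qed.

Lemma isom_cross_neq0 f x y z : isom f ->
  (cross (f y - f x) (f z - f x) == 0) = (cross (y - x) (z - x) == 0).
Proof.
by move=> fi; rewrite -[LHS]sqrf_eq0 -[RHS]sqrf_eq0 !expr2 isom_side.
Qed.

(** The difference of the linear parts kills two independent vectors, hence vanishes; then the
    translations agree too. *)
Lemma isom_uniq f g x y z : isom f -> isom g -> cross (y - x) (z - x) != 0 ->
  f x = g x -> f y = g y -> f z = g z -> f = g.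
Proof.
move=> [M [b [_ fE]]] [N [c [_ gE]]] nz ex ey ez.
have D v : f v = g v -> f x = g x -> (v - x) *m (M - N) = 0.
  rewrite !fE !gE mulmxBl !mulmxBr => ev ew.
  rewrite -(addrK b (v *m M)) ev -(addrK b (x *m M)) ew.
  by rewrite !opprB !opprD; apply/matrixP => i k; rewrite !mxE; ring.
have MN : M = N.
  apply/eqP; rewrite -subr_eq0; apply/eqP; set K := M - N in D *.
  have row0 (v : 'rV[R]_2) k : v *m K = 0 -> v 0 0 * K 0 k + v 0 1 * K 1 k = 0.
    by move=> vK; rewrite -mul2mxE vK mxE.
  apply/matrixP => i k.
  have := row0 _ k (D _ ey ex); have := row0 _ k (D _ ez ex).
  set p := (y - x) 0 0; set q := (y - x) 0 1.
  set r := (z - x) 0 0; set s := (z - x) 0 1; move=> e2 e1.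
  have cE : cross (y - x) (z - x) = p * s - q * r by [].
  have a0 : cross (y - x) (z - x) * K 0 k = 0.
    rewrite cE; transitivity (s * (p * K 0 k + q * K 1 k) - q * (r * K 0 k + s * K 1 k)).
      by ring.
    by rewrite e1 e2; ring.
  have a1 : cross (y - x) (z - x) * K 1 k = 0.
    rewrite cE; transitivity (p * (r * K 0 k + s * K 1 k) - r * (p * K 0 k + q * K 1 k)).
      by ring.
    by rewrite e1 e2; ring.
  by rewrite [RHS]mxE; case: (ord2P i) => ->; apply: (mulfI nz); rewrite ?a0 ?a1 mulr0.
apply/funext => v; rewrite fE gE MN; congr (_ + _).
by move: ex; rewrite fE gE MN => /addrI.
Qed.

Lemma det2 (M : 'M[R]_2) : \det M = M 0 0 * M 1 1 - M 0 1 * M 1 0.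
Proof.
rewrite (expand_det_row _ 0) sum2 /cofactor !det_mx11 !mxE /=.
have -> : lift 0 0 = 1 :> 'I_2 by apply/val_inj.
have -> : lift 1 0 = 0 :> 'I_2 by apply/val_inj.
by rewrite expr0 expr1; ring.
Qed.

Lemma isom_exists x y z x' y' z' : cross (y - x) (z - x) != 0 ->
  edist x y = edist x' y' -> edist x z = edist x' z' -> edist y z = edist y' z' ->
  exists f, [/\ isom f, f x = x', f y = y' & f z = z'].
Proof.
move=> nz xy xz yz.
pose W (a b c : 'rV[R]_2) : 'M[R]_2 := \matrix_(i, k) (if i == 0 then b - a else c - a) 0 k.
have W0 a b c k : W a b c 0 k = (b - a) 0 k by rewrite mxE.
have W1 a b c k : W a b c 1 k = (c - a) 0 k by rewrite mxE.
(* The rows of [W] are two edge vectors, so this is their Gram matrix, which by polarization depends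
   on the three distances only. *)
have gram : W x y z *m (W x y z)^T = W x' y' z' *m (W x' y' z')^T.
  have E a b c : W a b c *m (W a b c)^T = \matrix_(i, j)
      if i == 0 then (if j == 0 then dot (b - a) (b - a) else dot (b - a) (c - a))
      else (if j == 0 then dot (b - a) (c - a) else dot (c - a) (c - a)).
    apply/matrixP => i j; rewrite [RHS]mxE mxE sum2 ![_^T _ _]mxE.
    case: (ord2P i) => ->; case: (ord2P j) => -> /=; rewrite ?W0 ?W1 //.
    by rewrite /dot; ring.
  rewrite !E -!sqr_edist !dot_polar ![edist y x]edistC ![edist z x]edistC.
  by rewrite ![edist y' x']edistC ![edist z' x']edistC xy xz yz.
have Wu : W x y z \in unitmx.
  rewrite unitmxE unitfE; suff -> : \det (W x y z) = cross (y - x) (z - x) by [].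
  by rewrite det2 !W0 !W1 /cross.
(* Equal Gram matrices make [M] orthogonal. *)
pose M := invmx (W x y z) *m W x' y' z'.
have MM : M *m M^T = 1%:M.
  rewrite trmx_mul mulmxA -(mulmxA (invmx _)) -gram trmx_inv mulmxA mulVmx // mul1mx.
  by rewrite mulmxV // unitmx_tr.
have WM : W x y z *m M = W x' y' z' by rewrite mulmxA mulmxV // mul1mx.
have rowW a b c : row 0 (W a b c) = b - a by apply/rowP => k; rewrite !mxE.
have rowW' a b c : row 1 (W a b c) = c - a by apply/rowP => k; rewrite !mxE.
have yM : (y - x) *m M = y' - x' by rewrite -(rowW x y z) -row_mul WM rowW.
have zM : (z - x) *m M = z' - x' by rewrite -(rowW' x y z) -row_mul WM rowW'.
exists (fun v => v *m M + (x' - x *m M)); split.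
- by exists M, (x' - x *m M).
- by rewrite addrCA subrr addr0.
- by rewrite addrCA -mulmxBl yM subrKC.
- by rewrite addrCA -mulmxBl zM subrKC.
Qed.
End Plane.

(** * Sectors around a point *)

Section Polar.
Variable R : realType.
Implicit Types (a b r s t : R) (u w z : 'rV[R]_2).

Definition expi a : 'rV[R]_2 := \row_k (if k == 0 then cos a else sin a).

Lemma cross_expi r a s b : cross (r *: expi a) (s *: expi b) = r * s * sin (b - a).
Proof. by rewrite /cross sinB !mxE /=; ring. Qed.

Lemma dot_expi r a s b : dot (r *: expi a) (s *: expi b) = r * s * cos (b - a).
Proof. by rewrite /dot cosB !mxE /=; ring. Qed.

Lemma expi_neq0 a : expi a != 0.
Proof.
apply/eqP => e; have := dot_expi 1 a 1 a.
by rewrite e scaler0 subrr cos0 /dot !mxE; lra.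
Qed.

Lemma scale_expi_neq0 r a : 0 < r -> r *: expi a != 0.
Proof. by move=> r0; rewrite scaler_eq0 negb_or expi_neq0 gt_eqF. Qed.

Lemma edist_expi0 r a : 0 <= r -> edist 0 (r *: expi a) = r.
Proof.
move=> r0; apply/eqP; rewrite -(@eqrXn2 _ 2) ?edist_ge0 // sqr_edist sub0r.
by rewrite -scaleNr dot_expi subrr cos0; apply/eqP; ring.
Qed.

Lemma sqr_edist_expi r a s b :
  edist (r *: expi a) (s *: expi b) ^+ 2 = r ^+ 2 + s ^+ 2 - 2 * r * s * cos (b - a).
Proof.
rewrite sqr_edist; have -> u w : dot (u - w) (u - w) = dot u u + dot w w - 2 * dot u w.
  by rewrite /dot !mxE; ring.
by rewrite !dot_expi !subrr cos0; ring.
Qed.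

Lemma sin_lt0_Npi a : - pi < a < 0 -> sin a < 0.
Proof.
by move=> h; rewrite -oppr_gt0 -sinN sin_gt0_pi //; apply/andP; lra.
Qed.

Lemma cos_lt1 a : 0 < a < 2 * pi -> cos a < 1.
Proof.
move=> h; have s0 : 0 < sin (a / 2) by apply: sin_gt0_pi; apply/andP; lra.
have -> : a = (a / 2) *+ 2 by rewrite mulr2n; field.
rewrite cos_mulr2n cos2sin2; move: (mulr_gt0 s0 s0); rewrite -expr2; lra.
Qed.

Lemma cos_add2pi a : cos (a + 2 * pi) = cos a.
Proof. by rewrite mulr_natl cosD2pi. Qed.

Lemma sin_add2pi a : sin (a + 2 * pi) = sin a.
Proof. by rewrite mulr_natl sinD2pi. Qed.

Lemma cos_eq1_4pi a : 0 < a < 4 * pi -> cos a = 1 -> a = 2 * pi.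
Proof.
move=> h c; case: (ltrgtP a (2 * pi)) => // k.
- have := @cos_lt1 a; rewrite c ltxx; lra.
- have := @cos_lt1 (a - 2 * pi).
  by rewrite -(cos_add2pi (a - 2 * pi)) subrK c ltxx; lra.
Qed.

Lemma expiD2pi a : expi (a + 2 * pi) = expi a.
Proof. by apply/rowP => k; rewrite !mxE cos_add2pi sin_add2pi. Qed.

Lemma expi_eq r a s b : 0 < r -> 0 < s -> r *: expi a = s *: expi b ->
  r = s /\ cos (b - a) = 1.
Proof.
move=> r0 s0 e; have := dot_expi r a r a; have := dot_expi s b s b.
have := dot_expi r a s b; rewrite e !subrr cos0 => e1 e2.
rewrite e2 => e3.
have rs : r = s.
  apply/eqP; rewrite -(@eqrXn2 _ 2) ?ltW //; apply/eqP; move: e3; lra.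
split=> //; move: e1; rewrite e2 -rs !mulr1 => e1; apply: (@mulfI _ (r * r)).
  by rewrite mulf_neq0 ?gt_eqF.
by rewrite -e1 mulr1.
Qed.

(** The angle is found as [a + acos d], with [d] the cosine of the angle from [expi a]. The last two
    clauses record what happens on the bounding rays, where neighbouring sectors meet. *)
Lemma polar_between a b s t : a < b < a + pi -> 0 <= s -> 0 <= t ->
  s *: expi a + t *: expi b != 0 ->
  exists r c, [/\ 0 < r, a <= c <= b, s *: expi a + t *: expi b = r *: expi c,
    c = a -> t = 0 & c = b -> s = 0].
Proof.
move=> /andP[ab ba] s0 t0; set z := _ + _ => z0.
have sab : 0 < sin (b - a) by apply: sin_gt0_pi; apply/andP; lra.
have zz0 : 0 < dot z z.
  by rewrite lt_neqAle dot_ge0 eq_sym andbT; apply: contraNneq z0 => /dot0_eq0 ->.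
pose r := Num.sqrt (dot z z).
have r0 : 0 < r by rewrite sqrtr_gt0.
have r2 : r ^+ 2 = dot z z by rewrite sqr_sqrtr ?ltW.
have e1 : dot (expi a) (expi a) = 1.
  by rewrite -[X in dot X X]scale1r dot_expi subrr cos0; ring.
have crz : cross (expi a) z = t * sin (b - a).
  by rewrite /cross sinB !mxE /=; ring.
have czb : cross z (expi b) = s * sin (b - a).
  by rewrite /cross sinB !mxE /=; ring.
have lag := lagrange (expi a) z; rewrite e1 mul1r -r2 in lag.
pose d := dot (expi a) z / r.
have d2 : d ^+ 2 + (cross (expi a) z / r) ^+ 2 = 1.
  by rewrite !expr_div_n -mulrDl lag mulfV // expf_neq0 // gt_eqF.
have d1 : -1 <= d <= 1.
  rewrite -ler_norml -(@ler_pXn2r _ 2) ?nnegrE ?normr_ge0 ?ler01 //.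
  by rewrite real_normK ?num_real // expr1n -d2 lerDl sqr_ge0.
(* The sine of an arccosine is the nonnegative root; it is this cross product and not its opposite
   because [t] and [sin (b - a)] are nonnegative. *)
have sd : sin (acos d) = cross (expi a) z / r.
  rewrite sin_acos // -d2 addrC addKr sqrtr_sqr ger0_norm //.
  by rewrite crz divr_ge0 ?mulr_ge0 // ltW.
have zE : z = r *: expi (a + acos d).
  apply: (@eq_from_dot_cross _ (expi a)); first exact: expi_neq0.
    rewrite -[X in _ = dot X _]scale1r dot_expi mul1r addrC addKr acosK //.
    by rewrite /d mulrC divfK // gt_eqF.
  rewrite -[X in _ = cross X _]scale1r cross_expi mul1r [a + _]addrC addrK sd.
  by rewrite mulrC divfK // gt_eqF.
have a0 := acos_ge0 d1; have api := acos_lepi d1.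
have zb : r * sin (b - (a + acos d)) = s * sin (b - a).
  by rewrite -czb zE -[X in _ = cross _ X]scale1r cross_expi mulr1.
exists r, (a + acos d); split => //.
- apply/andP; split; first by lra.
  rewrite leNgt; apply/negP => lt.
  have : sin (b - (a + acos d)) < 0 by apply: sin_lt0_Npi; apply/andP; lra.
  rewrite -(pmulr_rlt0 _ r0) zb ltNge mulr_ge0 //; exact: ltW.
- move=> e; have := sd; have -> : acos d = 0 by lra.
  rewrite sin0 crz => /esym/eqP; rewrite !mulf_eq0 invr_eq0.
  by rewrite (gt_eqF r0) (gt_eqF sab) !orbF => /eqP.
- move=> e; move: zb; rewrite e subrr sin0 mulr0 => /esym/eqP.
  by rewrite mulf_eq0 (gt_eqF sab) orbF => /eqP.
Qed.

Lemma lin_comb_uniq u w s t s' t' : cross u w != 0 ->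
  s *: u + t *: w = s' *: u + t' *: w -> s = s' /\ t = t'.
Proof.
move=> nz e.
have A s1 t1 : cross u (s1 *: u + t1 *: w) = t1 * cross u w.
  by rewrite /cross !mxE; ring.
have B s1 t1 : cross (s1 *: u + t1 *: w) w = s1 * cross u w.
  by rewrite /cross !mxE; ring.
by split; apply: (mulIf nz); [rewrite -(B s t) -(B s' t')|rewrite -(A s t) -(A s' t')];
  rewrite e.
Qed.

Lemma expi_between a b c : a < b < a + pi -> expi c =
  (sin (b - c) / sin (b - a)) *: expi a + (sin (c - a) / sin (b - a)) *: expi b.
Proof.
move=> h; have s0 : sin (b - a) != 0.
  by rewrite gt_eqF // sin_gt0_pi //; apply/andP; lra.
by apply: (scalerI s0); apply: (@eq_from_dot_cross _ (expi a) _ _ (expi_neq0 _));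
  rewrite /dot /cross !mxE /= !sinB; field; rewrite -sinB.
Qed.

(** * Consecutive sectors with real-valued direction angles *)

Section Fan.
Variables (k : nat) (r S : nat -> R).
Hypotheses (r_gt0 : forall j, (j <= k)%N -> 0 < r j) (S0 : S 0 = 0)
  (S_step : forall j, (j < k)%N -> S j < S j.+1 < S j + pi).
Let w j := r j *: expi (S j).

Lemma S_mono i j : (i < j)%N -> (j <= k)%N -> S i < S j.
Proof.
elim: j => // j IH; rewrite ltnS leq_eqVlt => /orP[/eqP <-|ij] jk.
  by case/andP: (S_step jk).
by apply: (lt_trans (IH ij (ltnW jk))); case/andP: (S_step jk).
Qed.

Lemma S_le i j : (i <= j)%N -> (j <= k)%N -> S i <= S j.
Proof.
by rewrite leq_eqVlt => /orP[/eqP -> //|ij] jk; rewrite ltW // S_mono.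
Qed.

Lemma fan_cross_gt0 j : (j < k)%N -> 0 < cross (w j) (w j.+1).
Proof.
move=> jk; rewrite cross_expi !mulr_gt0 ?r_gt0 ?(ltnW jk) //.
by apply: sin_gt0_pi; move: (S_step jk) => ?; apply/andP; lra.
Qed.

Lemma fan_polar i s t : (i < k)%N -> 0 <= s -> 0 <= t -> s *: w i + t *: w i.+1 != 0 ->
  exists rho c, [/\ 0 < rho, S i <= c <= S i.+1, s *: w i + t *: w i.+1 = rho *: expi c,
    c = S i -> t = 0 & c = S i.+1 -> s = 0].
Proof.
move=> ik s0 t0; rewrite /w !scalerA => nz.
have ri : 0 < r i by rewrite r_gt0 // ltnW.
have ri1 : 0 < r i.+1 by rewrite r_gt0.
have [||rho [c [h1 h2 h3 h4 h5]]] := polar_between (S_step ik) _ _ nz.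
- by rewrite mulr_ge0 // ltW.
- by rewrite mulr_ge0 // ltW.
exists rho, c; split=> //.
  by move/h4/eqP; rewrite mulf_eq0 (gt_eqF ri1) orbF => /eqP.
by move/h5/eqP; rewrite mulf_eq0 (gt_eqF ri) orbF => /eqP.
Qed.

Lemma scale_fan_eq0 j s : (j <= k)%N -> (s *: w j == 0) = (s == 0).
Proof.
by move=> jk; rewrite scaler_eq0 (negPf (scale_expi_neq0 _ (r_gt0 jk))) orbF.
Qed.

Lemma scale_fan_inj j s t : (j <= k)%N -> s *: w j = t *: w j -> s = t.
Proof.
move=> jk /eqP; rewrite -subr_eq0 -scalerBl scale_fan_eq0 // subr_eq0.
by move=> /eqP.
Qed.

(* The coefficients agree as weights on the rays, ray [k] being identified with
   ray [0]; [F] is a test function on the rays. *)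
Lemma fan_inj i j s t s' t' (F : nat -> R) : S k = 2 * pi -> w k = w 0 -> F k = F 0 ->
  (i < k)%N -> (j < k)%N -> 0 <= s -> 0 <= t -> 0 <= s' -> 0 <= t' ->
  s *: w i + t *: w i.+1 = s' *: w j + t' *: w j.+1 ->
  s * F i + t * F i.+1 = s' * F j + t' * F j.+1.
Proof.
move=> Sk wk Fk; wlog ij : i j s t s' t' / (i <= j)%N.
  move=> H ik jk; case/orP: (leq_total i j) => ij; first exact: H.
  by move=> *; apply/esym/H.
move=> ik jk s0 t0 s'0 t'0 e.
(* The origin has no polar angle; there, independence of two consecutive [w] makes all coefficients
   vanish. *)
have [z0|z0] := eqVneq (s *: w i + t *: w i.+1) 0.
  have Z m p q : (m < k)%N -> p *: w m + q *: w m.+1 = 0 -> p = 0 /\ q = 0.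
    move=> mk e0; apply: (@lin_comb_uniq (w m) (w m.+1)).
      by rewrite gt_eqF ?fan_cross_gt0.
    by rewrite e0 !scale0r addr0.
  have [-> ->] := Z _ _ _ ik z0; rewrite e in z0.
  by have [-> ->] := Z _ _ _ jk z0; rewrite !mul0r.
move: ij; rewrite leq_eqVlt => /orP[/eqP ij|ij].
  rewrite -ij in e *; have [|-> -> //] := lin_comb_uniq _ e.
  by rewrite gt_eqF ?fan_cross_gt0.
have [rho [c [rho0 ci zc cs ct]]] := fan_polar ik s0 t0 z0.
have z0' : s' *: w j + t' *: w j.+1 != 0 by rewrite -e.
have [rho' [c' [rho0' cj zc' cs' ct']]] := fan_polar jk s'0 t'0 z0'.
have [_ cc] := expi_eq rho0 rho0' (etrans (esym zc) (etrans e zc')).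
have Sij : S i.+1 <= S j by apply: S_le => //; exact: ltnW.
have Si : 0 <= S i by rewrite -S0; apply: S_le => //; exact: ltnW.
have Sj : S j.+1 <= 2 * pi by rewrite -Sk; exact: S_le.
(* Both angles lie in [[0, 2 pi]], [c <= c'], and [cos (c' - c) = 1]. If they are equal, the point
   is on the ray common to two consecutive sectors. *)
have [lt2|ge2] := ltP (c' - c) (2 * pi).
  have ec : c = c'.
    apply/eqP/negPn/negP => ne; have := @cos_lt1 (c' - c).
    by rewrite cc ltxx; move: ne; rewrite neq_lt; lra.
  have Eij : i.+1 = j.
    apply/eqP/negPn/negP => ne; have : S i.+1 < S j; last by lra.
    by apply: S_mono; [rewrite ltn_neqAle ne|exact: ltnW].
  have s_0 : s = 0 by apply: ct; rewrite Eij; rewrite Eij in ci; lra.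
  have t_0 : t' = 0 by apply: cs'; rewrite -Eij; rewrite -Eij in cj; lra.
  rewrite -Eij s_0 t_0 !scale0r add0r addr0 in e *.
  by rewrite !mul0r add0r addr0 (scale_fan_inj ik e).
(* Now [c = 0] and [c' = 2 pi]: the point is on the ray along which the last sector meets the
   first. *)
have Ei : i = 0%N.
  by case: i ik ci Si {ij cs ct e zc z0 Sij} => // i ik ci Si;
    exfalso; have := @S_mono 0%N i.+1 isT (ltnW ik); rewrite S0; lra.
have Ej : j.+1 = k.
  apply/eqP/negPn/negP => ne; have := @S_mono j.+1 k.
  by rewrite ltn_neqAle ne jk leqnn Sk => /(_ isT isT); lra.
have t_0 : t = 0 by apply: cs; rewrite Ei S0; lra.
have s_0 : s' = 0 by apply: ct'; rewrite Ej Sk; lra.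
rewrite Ei Ej t_0 s_0 !scale0r add0r addr0 wk in e *.
by rewrite !mul0r add0r addr0 Fk (scale_fan_inj (leq0n k) e).
Qed.

(** Some sector [j] extends beyond the angle [2 pi], and directions just beyond it are also
    directions just beyond [0], inside sector [0]. Positivity of the four coefficients puts the
    common point in the interior of both sectors. *)
Lemma fan_overlap : 4 * pi <= S k -> exists j s t s' t',
  [/\ (0 < j < k)%N, 0 < s, 0 < t, 0 < s' & 0 < t' /\
      s *: w 0 + t *: w 1 = s' *: w j + t' *: w j.+1].
Proof.
move=> Sk; have pi0 := pi_gt0 R.
have [|n + min_n] := @ex_minnP (fun j => (j <= k)%N && (2 * pi < S j)).
  by exists k; rewrite leqnn; lra.
case: n min_n => [|j] min_j /andP[jk Sj]; first by exfalso; move: Sj; rewrite S0; lra.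
have Sj' : S j <= 2 * pi.
  rewrite leNgt; apply/negP => lt; have := min_j j; rewrite lt ltnW // ltnn.
  by move=> /(_ isT).
have k0 : (0 < k)%N by exact: leq_ltn_trans jk.
have S1 := S_step k0; rewrite S0 in S1.
have j0 : (0 < j)%N.
  by case: j {min_j Sj'} jk Sj => // _ Sj; exfalso; lra.
(* At most half the opening of sector [0] and half the excess of sector [j] over [2 pi], so that [d]
   and [d + 2 pi] are interior to these sectors. *)
pose d := Num.min (S 1%N / 2) ((S j.+1 - 2 * pi) / 2).
have d0 : 0 < d by rewrite lt_min; apply/andP; split; lra.
have d1 : d <= S 1%N / 2 by rewrite ge_min lexx.
have d2 : d <= (S j.+1 - 2 * pi) / 2 by rewrite ge_min lexx orbT.
have H i c : (i < k)%N -> S i < c < S i.+1 ->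
    exists s t, [/\ 0 < s, 0 < t & s *: w i + t *: w i.+1 = expi c].
  move=> ik h; have Si := S_step ik; have ri := r_gt0 (ltnW ik); have ri1 := r_gt0 ik.
  have p0 : 0 < sin (S i.+1 - S i) by apply: sin_gt0_pi; apply/andP; lra.
  have p1 : 0 < sin (S i.+1 - c) by apply: sin_gt0_pi; apply/andP; lra.
  have p2 : 0 < sin (c - S i) by apply: sin_gt0_pi; apply/andP; lra.
  exists (sin (S i.+1 - c) / sin (S i.+1 - S i) / r i),
    (sin (c - S i) / sin (S i.+1 - S i) / r i.+1).
  rewrite !divr_gt0 //; split=> //.
  by rewrite /w !scalerA !divfK ?gt_eqF // -expi_between.
have [|s [t [s0 t0 e]]] := H 0%N d k0; first by rewrite S0; lra.
have [|s' [t' [s'0 t'0 e']]] := H j (d + 2 * pi) jk; first by lra.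
by exists j, s, t, s', t'; rewrite j0 jk e e' expiD2pi.
Qed.
End Fan.
End Polar.

(** * Links of vertices *)

Section Links.
Variable n : nat.
Implicit Types (T : {set {set 'I_n}}) (t e : {set 'I_n}) (v a b : 'I_n) (c : nat -> 'I_n).

Local Notation tri a b c := [set a; b; c]%SET.

Lemma triAC a b v : tri a b v = tri a v b.
Proof. by apply/setP => x; rewrite !inE orbAC. Qed.

Lemma triC a b v : tri a b v = tri b a v.
Proof. by apply/setP => x; rewrite !inE; congr (_ || _); rewrite orbC. Qed.

Lemma tri_neq a b v : #|tri a b v| = 3 -> [/\ a != b, a != v & b != v].
Proof.
have sub x y z : #|tri x y z| = 3 -> x != y.
  by move=> h; apply/eqP => e; move: h; rewrite e finset.setUid cards2; case: (_ != _).
by move=> h; split; [apply: sub h|rewrite triAC in h; apply: sub h|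
  rewrite triC triAC in h; apply: sub h].
Qed.

Lemma triP t v : #|t| = 3 -> v \in t -> exists a b, t = tri v a b.
Proof.
move=> t3 vt; have : #|(t :\ v)%SET| == 2 by move: t3; rewrite (cardsD1 v t) vt add1n => /eqP.
move=> /cards2P[a [b [_ e]]]; exists a, b; rewrite -[LHS](finset.setD1K vt) e.
by apply/setP => x; rewrite !inE orbA.
Qed.

Lemma tri_inj v a b b' : #|tri v a b| = 3 -> tri v a b = tri v a b' -> b = b'.
Proof.
move=> /tri_neq[_ vb ab] /setP/(_ b); rewrite !inE eqxx orbT.
by rewrite ![b == _]eq_sym (negPf vb) (negPf ab) /= => /esym/eqP ->.
Qed.

Definition star T v : {set {set 'I_n}} := [set t in T | v \in t]%SET.

(* [c 0, ..., c k] runs through the link of [v]; it is closed up when [c k = c 0]. *)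
Definition fan T v k c : Prop :=
  [/\ forall i j, (i < k)%N -> (j < k)%N -> c i = c j -> i = j,
      (2 < k)%N /\ c k = c 0 \/ (0 < k)%N /\ forall i, (i < k)%N -> c i != c k &
      forall a b, link T v a b <->
        exists2 j, (j < k)%N & (a = c j /\ b = c j.+1) \/ (a = c j.+1 /\ b = c j)].

Lemma cyclic_link_fan T v s : cyclic_link T v s ->
  let c j := nth v s (j %% size s) in
  [/\ fan T v (size s) c, c (size s) = c 0,
      forall j, (j < size s)%N -> next s (c j) = c j.+1 & forall j, (j < size s)%N -> nth v s j = c j].
Proof.
move=> [us s2 sl] c; have cS j : (j < size s)%N -> c j = nth v s j.
  by move=> js; rewrite /c modn_small.
have s0 : (0 < size s)%N by apply: ltn_trans s2.
have ck : c (size s) = c 0%N by rewrite /c modnn mod0n.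
have nx j : (j < size s)%N -> next s (c j) = c j.+1.
  move=> js; rewrite cS // next_nth mem_nth // index_uniq //.
  rewrite /c; case: s {s2 sl cS ck s0 c} us js => //= y s us js.
  move: (js); rewrite ltnS leq_eqVlt => /orP[/eqP ->|js'].
    by rewrite modnn /= nth_default.
  by rewrite modn_small //=; apply: set_nth_default.
have cin j : c j \in s by rewrite /c mem_nth // ltn_mod.
split=> //; last by move=> j /cS.
split.
- by move=> i j ik jk; rewrite !cS // => /eqP; rewrite nth_uniq // => /eqP.
- by left.
move=> a b; rewrite sl; split.
  move=> /andP[ain /orP[/eqP ->|/eqP ->]].
    exists (index a s); rewrite ?index_mem //; left.
    by rewrite -nx ?index_mem // cS ?index_mem // nth_index.
  have pin : prev s a \in s by rewrite mem_prev.
  exists (index (prev s a) s); rewrite ?index_mem //; right.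
  by rewrite -nx ?index_mem // cS ?index_mem // nth_index // next_prev.
move=> [j js [[-> ->]|[-> ->]]]; rewrite cin /= -nx //; first by rewrite eqxx.
by rewrite prev_next // eqxx orbT.
Qed.

(** A path of neighbours spans with [v] one triangle fewer than it has vertices, whence the
    predecessor. *)
Lemma path_link_fan T v s : path_link T v s ->
  fan T v (size s).-1 (nth v s) /\ nth v s (size s).-1 != nth v s 0.
Proof.
move=> [us s1 sl].
have s0 : (0 < size s)%N := ltnW s1.
have lt j : (j < (size s).-1)%N -> (j < size s)%N.
  by move=> js; rewrite -(prednK s0) ltnW.
have ltS j : (j < (size s).-1)%N -> (j.+1 < size s)%N.
  by move=> js; rewrite -(prednK s0).
have k0 : (0 < (size s).-1)%N by rewrite -ltnS prednK.
have ne i : (i < (size s).-1)%N -> nth v s i != nth v s (size s).-1.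
  by move=> ik; rewrite nth_uniq ?(lt _ ik) ?ltn_predL // neq_ltn ik.
have ix x y : infix [:: x; y] s <-> exists2 j, (j < (size s).-1)%N &
    x = nth v s j /\ y = nth v s j.+1.
  split=> [/infixP[p [q ->]]|[j js [-> ->]]].
    exists (size p); first by rewrite !size_cat /=; lia.
    by split; rewrite nth_cat ?ltnn ?subnn // ltnNge leqnSn subSnn.
  apply/infixP; exists (take j s), (drop j.+2 s).
  by rewrite /= -!drop_nth ?cat_take_drop ?ltS // lt.
split; last by rewrite eq_sym; apply: ne.
split.
- by move=> i j ik jk /eqP; rewrite nth_uniq ?lt // => /eqP.
- by right.
move=> a b; rewrite sl; split.
  move=> /orP[/ix|/ix] [j jk [-> ->]]; exists j => //; [by left|by right].
move=> [j jk [[-> ->]|[-> ->]]]; apply/orP; [left|right]; apply/ix; by exists j.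
Qed.

(** * Triangles and edges at a vertex, read off its fan *)

Section Surface.
Variables (T : {set {set 'I_n}}) (v : 'I_n) (k : nat) (c : nat -> 'I_n).
Hypotheses (T3 : forall t, t \in T -> #|t| = 3) (cF : fan T v k c).

Lemma fan_gt0 : (0 < k)%N.
Proof. by case: cF => _ [[/ltnW/ltnW//]|[]]. Qed.

Lemma fan_tri j : (j < k)%N -> tri v (c j) (c j.+1) \in T.
Proof.
by case: cF => _ _ H jk; apply/(H (c j) (c j.+1)); exists j => //; left.
Qed.

Lemma fan_triP t : t \in T -> v \in t -> exists2 j, (j < k)%N & t = tri v (c j) (c j.+1).
Proof.
move=> tT vt; have [a [b e]] := triP (T3 tT) vt.
have : link T v a b by rewrite /link -e.
case: cF => _ _ H /H[j jk [[ea eb]|[ea eb]]]; exists j => //.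
  by rewrite e ea eb.
by rewrite e ea eb triAC.
Qed.

Lemma fan_neq j : (j < k)%N -> [/\ v != c j, v != c j.+1 & c j != c j.+1].
Proof. by move=> /fan_tri/T3/tri_neq. Qed.

Lemma fan_neqv j : (j <= k)%N -> v != c j.
Proof.
have k0 := fan_gt0; case: j => [|j] jk; first by have [] := fan_neq k0.
by have [] := fan_neq jk.
Qed.

(** On the shifted range [1, ..., k] the map [c] is injective too: in a closed fan [c k] merely
    replaces [c 0]. *)
Lemma fan_injS i j : (i < k)%N -> (j < k)%N -> c i.+1 = c j.+1 -> i = j.
Proof.
have [ci ck _] := cF.
wlog ij : i j / (i < j)%N.
  move=> H ik jk e; case: (ltngtP i j) => // ij; first exact: H.
  by apply/esym; apply: H => //; rewrite e.
move=> ik jk; case: (ltnP j.+1 k) => jk1 e.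
  have : i.+1 = j.+1 by apply: ci => //; lia.
  by case.
have Ej : j.+1 = k by lia.
rewrite Ej in e; case: ck => [[_ ck]|[_ /(_ i.+1)]]; last by rewrite e eqxx; lia.
by rewrite ck in e; have : i.+1 = 0%N by [apply: ci => //; lia]; lia.
Qed.

(** A neighbour is the start of at most one step of the fan and the end of at most one, so of two
    triangles on the edge [v a] one leaves [a] and the other arrives there. This is the source of
    the opposite signs of area. *)
Lemma fan_opposite a b b' : tri v a b \in T -> tri v a b' \in T -> b != b' ->
  exists i j, [/\ (i < k)%N, (j < k)%N, a = c i, a = c j.+1 &
    (b = c i.+1 /\ b' = c j) \/ (b' = c i.+1 /\ b = c j)].
Proof.
have [ci _ H] := cF => /H[i ik [[ea eb]|[ea eb]]] /H[j jk [[ea' eb']|[ea' eb']]] ne.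
- have E : i = j by apply: ci => //; rewrite -ea -ea'.
  by rewrite eb eb' E eqxx in ne.
- by exists i, j; split=> //; left.
- by exists j, i; split=> //; right.
- have E : i = j by apply: fan_injS => //; rewrite -ea -ea'.
  by rewrite eb eb' E eqxx in ne.
Qed.

(** The vertex [c 0] is never reached again, so the edge from [v] to it lies in the first triangle
    only. *)
Lemma open_fan_boundary : c k != c 0 -> exists2 e, e \in boundary_edges T & v \in e.
Proof.
move=> ck; have k0 := fan_gt0; have [ci _ _] := cF.
have [vc0 vc1 c01] := fan_neq k0.
exists [set v; c 0]%SET; last by rewrite !inE eqxx.
rewrite inE; apply/andP; split.
  rewrite inE cards2 vc0 eqxx; apply/existsP; exists (tri v (c 0%N) (c 1%N)).
  by rewrite fan_tri // finset.subsetUl.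
apply/cards1P; exists (tri v (c 0%N) (c 1%N)); apply/setP => t; rewrite inE finset.in_set1.
apply/andP/eqP => [[tT]|->]; last by rewrite fan_tri // finset.subsetUl.
rewrite finset.subUset !finset.sub1set => /andP[vt c0t].
have [j jk e] := fan_triP tT vt; rewrite e in c0t *.
move: c0t; rewrite !inE eq_sym (negPf vc0) /= => /orP[/eqP e0|/eqP e0].
  by have -> : j = 0%N by apply: ci.
have : (j.+1 < k)%N.
  by rewrite ltn_neqAle jk andbT; apply: contraNneq ck => <-; rewrite e0.
by move=> jk1; have := ci _ _ k0 jk1 e0.
Qed.

Lemma closed_fan_gt2 : c k = c 0 -> (2 < k)%N.
Proof.
by move=> ck; case: cF => _ [[k2 _] //|[k0 /(_ 0%N k0)]]; rewrite ck eqxx.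
Qed.

(** In a cycle of at least three neighbours no step is the reverse of another; hence the triangles
    before and after a neighbour differ. *)
Lemma fan_no_2cycle m p : c k = c 0 -> (m < k)%N -> (p < k)%N ->
  c m.+1 = c p -> c p.+1 = c m -> False.
Proof.
move=> ck mk pk; have k2 := closed_fan_gt2 ck; have [ci _ _] := cF.
have succ i j : (i < k)%N -> (j < k)%N -> c i.+1 = c j ->
    i.+1 = j \/ i.+1 = k /\ j = 0%N.
  move=> ik jk; have [ik1|ik1] := ltnP i.+1 k; first by left; apply: ci.
  have E : i.+1 = k by apply/eqP; rewrite eqn_leq ik.
  by rewrite E ck => e; right; split=> //; apply: ci => //; exact: ltnW (ltnW _).
move=> /(succ _ _ mk pk) H1 /(succ _ _ pk mk) H2.
by clear -H1 H2 k2; lia.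
Qed.

Lemma closed_fan_interior : c k = c 0 -> interior_vertex T v.
Proof.
move=> ck; have k0 := fan_gt0; have [ci _ _] := cF.
apply/forallP => e; apply/implyP; rewrite !inE => /andP[/andP[e2 /existsP[t /andP[tT et]]] e1].
apply/negP => ve; have [j jk tE] := fan_triP tT (fintype.subsetP et _ ve).
have [x [y [xy eE]]] := cards2P _ e2.
have [a [ea va]] : exists a, e = [set v; a]%SET /\ v != a.
  move: ve; rewrite eE !inE => /orP[/eqP ->|/eqP ->]; first by exists y.
  by exists x; rewrite finset.setUC eq_sym.
have [m mk am] : exists2 m, (m < k)%N & a = c m.
  have : a \in t by rewrite (fintype.subsetP et) // ea !inE eqxx orbT.
  rewrite tE !inE eq_sym (negPf va) /= => /orP[/eqP ->|/eqP ->]; first by exists j.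
  move: jk; rewrite leq_eqVlt => /orP[/eqP ->|jk]; last by exists j.+1.
  by exists 0%N.
(* [p] is the cyclic predecessor of [m]; triangles [m] and [p] are the two on the edge from [v] to
   [c m]. *)
have [p pk pm] : exists2 p, (p < k)%N & c p.+1 = c m.
  case: m mk am => [|m] mk am; last by exists m => //; exact: ltnW.
  by exists k.-1; rewrite ?prednK // ltn_predL.
have [vm vm1 mm1] := fan_neq mk; have [vp vp1 pp1] := fan_neq pk.
have ne : tri v (c m) (c m.+1) != tri v (c p) (c p.+1).
  rewrite pm triAC; apply/eqP => /setP/(_ (c m.+1)); rewrite !inE eqxx orbT.
  rewrite ![c m.+1 == _]eq_sym (negPf vm1) (negPf mm1) /= orbF => /esym/eqP epm.
  exact: (@fan_no_2cycle m p).
move/cards1P: e1 => [z zE]; case/eqP: ne.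
have inz m' : (m' < k)%N -> e \subset tri v (c m') (c m'.+1) -> tri v (c m') (c m'.+1) = z.
  by move=> mk' em; apply/eqP; rewrite -finset.in_set1 -zE inE fan_tri.
have em : e \subset tri v (c m) (c m.+1).
  by rewrite ea am finset.subUset !finset.sub1set !inE !eqxx !orbT.
have ep : e \subset tri v (c p) (c p.+1).
  by rewrite ea am -pm finset.subUset !finset.sub1set !inE !eqxx !orbT.
by rewrite (inz m mk em) (inz p pk ep).
Qed.

End Surface.
End Links.

(** * Placements of the vertices *)

Section Placements.
Variables (R : realType) (n : nat).
Implicit Types (T : {set {set 'I_n}}) (t e : {set 'I_n}) (a b p q v x y z : 'I_n)
  (l : {set 'I_n} -> R) (c : nat -> 'I_n) (P Q : 'I_n -> 'rV[R]_2).

Local Notation tri a b c := [set a; b; c]%SET.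
Local Notation pair a b := [set a; b]%SET.

(* Twice the signed area. *)
Definition area P x y z := cross (P y - P x) (P z - P x).

Lemma areaC P x y z : area P y x z = - area P x y z.
Proof. exact: cross_rebase. Qed.

Lemma areaAC P x y z : area P x z y = - area P x y z.
Proof. exact: crossC. Qed.

(** The two swaps generate all orderings of three vertices. This is needed because triangles are
    unordered sets while areas depend on the order. *)
Lemma tri_perm_ind (K : 'I_n -> 'I_n -> 'I_n -> Prop) x y z p q a :
  (forall x y z, K x y z -> K y x z) -> (forall x y z, K x y z -> K x z y) ->
  #|tri p q a| = 3 -> tri p q a = tri x y z -> K x y z -> K p q a.
Proof.
move=> KC KA h e k0; have [pq pa qa] := tri_neq h.
have in3 w : w \in tri p q a -> [\/ w = x, w = y | w = z].
  by rewrite e !inE -orbA => /or3P[]/eqP; [constructor 1|constructor 2|constructor 3].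
have xyz : K y x z /\ K y z x /\ K z x y /\ K z y x /\ K x z y.
  have k1 := KC _ _ _ k0; have k2 := KA _ _ _ k0; have k3 := KA _ _ _ k1.
  by have k4 := KC _ _ _ k2; have k5 := KC _ _ _ k3.
have [k1 [k2 [k3 [k4 k5]]]] := xyz.
have /in3 : p \in tri p q a by rewrite !inE eqxx.
have /in3 : q \in tri p q a by rewrite !inE eqxx orbT.
have /in3 : a \in tri p q a by rewrite !inE eqxx orbT.
by case=> ea; case=> eq; case=> ep; move: pq pa qa; rewrite ?ea ?eq ?ep ?eqxx.
Qed.

(** Areas are constrained only relatively to each other, so reflections preserve the notion; every
    clause speaks of triangles of [T], so that a single star can be taken for [T]. *)
Definition placed T l P : Prop :=
  [/\ forall t p q, t \in T -> p \in t -> q \in t -> p != q ->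
        edist (P p) (P q) = l (pair p q),
      forall x y z, tri x y z \in T -> area P x y z != 0 &
      forall p q a b, tri p q a \in T -> tri p q b \in T -> a != b ->
        area P p q a * area P p q b < 0].

Lemma placed_sub T T' l P : T' \subset T -> placed T l P -> placed T' l P.
Proof.
move=> /fintype.subsetP sT [D1 D2 D3]; split=> [t p q /sT|x y z /sT|p q a b /sT + /sT].
- exact: D1.
- exact: D2.
- exact: D3.
Qed.

Definition tri_ineq T l := forall i j k, tri i j k \in T ->
  l (pair i k) < l (pair i j) + l (pair j k).

Definition fan_angle l v c j := angle l (c j) v (c j.+1).
Definition fan_sum l v c j := \sum_(i < j) fan_angle l v c i.

Section Fixed.
Variables (T : {set {set 'I_n}}) (l : {set 'I_n} -> R).
Hypothesis T3 : forall t, t \in T -> #|t| = 3.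
Hypothesis l_gt0 : forall e : {set 'I_n}, e \in edges T -> 0 < l e.

Lemma tri_edge x y z : tri x y z \in T -> pair x y \in edges T.
Proof.
move=> xyz; have [xy _ _] := tri_neq (T3 xyz).
by rewrite inE cards2 xy eqxx; apply/existsP; exists (tri x y z); rewrite xyz finset.subsetUl.
Qed.

Lemma tri_edges x y z : tri x y z \in T ->
  [/\ pair x y \in edges T, pair x z \in edges T & pair y z \in edges T].
Proof.
move=> xyz; split; first exact: tri_edge xyz.
  by rewrite triAC in xyz; exact: tri_edge xyz.
by rewrite triC triAC in xyz; exact: tri_edge xyz.
Qed.

Lemma angle_law v a b : tri_ineq T l -> tri v a b \in T ->
  0 < angle l a v b < pi /\
  l (pair a b) ^+ 2 = l (pair v a) ^+ 2 + l (pair v b) ^+ 2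
    - 2 * l (pair v a) * l (pair v b) * cos (angle l a v b).
Proof.
move=> ti vab; have [/l_gt0 va0 /l_gt0 vb0 /l_gt0 ab0] := tri_edges vab.
have := ti v a b vab.
have := ti v b a; rewrite triAC => /(_ vab).
have := ti a v b; rewrite triC => /(_ vab).
rewrite /angle ![pair a v]finset.setUC ![pair b a]finset.setUC.
set p := l (pair v a) in va0 *; set q := l (pair v b) in vb0 *.
set r := l (pair a b) in ab0 *; set C := _ / _ => h1 h2 h3.
have pq0 : 0 < 2 * p * q by rewrite !mulr_gt0.
have CE : C * (2 * p * q) = p ^+ 2 + q ^+ 2 - r ^+ 2 by rewrite divfK // gt_eqF.
(* [C < 1] amounts to [(p - q)^2 < r^2] and [-1 < C] to [r^2 < (p + q)^2], that is, to the strict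
   triangle inequalities. *)
have C1 : C < 1 by rewrite -(ltr_pM2r pq0) CE; nra.
have C0 : -1 < C by rewrite -(ltr_pM2r pq0) CE; nra.
have a0 : 0 < acos C by apply: acos_gt0; rewrite C1 andbT ltW.
have api : acos C < pi by apply: acos_ltpi; rewrite C0 ltW.
split; first by rewrite a0.
rewrite acosK ?in_itv /= ?(ltW C0) ?(ltW C1) // [_ * C]mulrC CE; ring.
Qed.

(** By the Lagrange identity a nonzero area makes the Cauchy-Schwarz inequality at [P j] strict, and
    the law of cosines turns this into the strict triangle inequality. *)
Lemma placed_tri_ineq P : placed T l P -> tri_ineq T l.
Proof.
move=> [D1 D2 _] i j k ijk; have [ij ik jk] := tri_neq (T3 ijk).
rewrite -!(D1 _ _ _ ijk) ?inE ?eqxx ?orbT // {D1}.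
have := D2 _ _ _ ijk; rewrite /area => nz.
have := dot_polar (P j) (P i) (P k); set d := dot _ _.
have lag := lagrange (P i - P j) (P k - P j).
have c2 : 0 < cross (P i - P j) (P k - P j) ^+ 2.
  by rewrite lt_neqAle sqr_ge0 andbT eq_sym sqrf_eq0 cross_rebase oppr_eq0.
rewrite -!sqr_edist ![edist _ (P j)]edistC -/d in lag.
rewrite -[edist (P i) (P j)]edistC.
have p0 := edist_ge0 (P j) (P i); have q0 := edist_ge0 (P j) (P k).
have r0 := edist_ge0 (P i) (P k).
set p := edist (P j) (P i) in lag p0 *; set q := edist (P j) (P k) in lag q0 *.
set r := edist (P i) (P k) in r0 * => dE.
have dpq : - (p * q) < d.
  rewrite ltNge; apply/negP => h; have : (p * q) ^+ 2 <= d ^+ 2; last first.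
    by rewrite exprMn -lag; lra.
  rewrite -[d ^+ 2]sqrrN ler_pXn2r ?nnegrE ?mulr_ge0 //; first by lra.
  by have := mulr_ge0 p0 q0; lra.
rewrite ltNge; apply/negP => h.
have : (p + q) ^+ 2 <= r ^+ 2 by rewrite ler_pXn2r ?nnegrE ?addr_ge0.
by rewrite sqrrD; move: dE dpq; lra.
Qed.

(** * Laying out the star of a vertex *)

Section FanPlacement.
Variables (v : 'I_n) (k : nat) (c : nat -> 'I_n).
Hypotheses (cF : fan T v k c) (ti : tri_ineq T l).
Let S := fan_sum l v c.
Let r j := l (pair v (c j)).

Lemma fan_sum0 : S 0 = 0.
Proof. by rewrite /S /fan_sum big_ord0. Qed.

Lemma fan_sumS j : S j.+1 = S j + fan_angle l v c j.
Proof. by rewrite /S /fan_sum big_ord_recr. Qed.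

Lemma fan_step j : (j < k)%N -> S j < S j.+1 < S j + pi.
Proof.
move=> /(fan_tri cF) vt; rewrite fan_sumS /fan_angle.
by have [] := angle_law ti vt; lra.
Qed.

Lemma fan_radius_gt0 j : (j <= k)%N -> 0 < r j.
Proof.
have k0 := fan_gt0 cF; case: j => [|j] jk.
  by have [/l_gt0] := tri_edges (fan_tri cF k0).
by have [_ /l_gt0] := tri_edges (fan_tri cF jk).
Qed.

Lemma fan_edge j : (j < k)%N ->
  edist (r j *: expi (S j)) (r j.+1 *: expi (S j.+1)) = l (pair (c j) (c j.+1)).
Proof.
move=> jk; have vt := fan_tri cF jk; have [_ _ /l_gt0 ab0] := tri_edges vt.
apply/eqP; rewrite -(@eqrXn2 _ 2) ?edist_ge0 ?(ltW ab0) // sqr_edist_expi.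
by have [_ ->] := angle_law ti vt; rewrite fan_sumS [S j + _]addrC addrK.
Qed.

(** All triangles turn counterclockwise around [v], and consecutive ones traverse their common edge
    in opposite directions. For a closed fan the hypothesis at [0] and [k] together contains the
    closing condition. *)
Lemma star_placed Q : Q v = 0 -> (forall j, (j <= k)%N -> Q (c j) = r j *: expi (S j)) ->
  placed (star T v) l Q.
Proof.
move=> Qv Qc.
have pos j : (j < k)%N -> 0 < area Q v (c j) (c j.+1).
  move=> jk; rewrite /area Qv !subr0 !Qc //; last exact: ltnW.
  exact: (fan_cross_gt0 fan_radius_gt0 fan_step).
have Qe j : (j < k)%N -> [/\ edist (Q v) (Q (c j)) = l (pair v (c j)),
   edist (Q v) (Q (c j.+1)) = l (pair v (c j.+1)) &
   edist (Q (c j)) (Q (c j.+1)) = l (pair (c j) (c j.+1))].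
  move=> jk; have jk' := ltnW jk; rewrite Qv !Qc // fan_edge //.
  by rewrite !edist_expi0 // ltW // fan_radius_gt0.
split.
- move=> t p q; rewrite inE => /andP[tT vt]; have [j jk ->] := fan_triP T3 cF tT vt.
  have [e1 e2 e3] := Qe j jk.
  rewrite !inE -!orbA => /or3P[]/eqP -> /or3P[]/eqP ->; rewrite ?eqxx // => _;
  by rewrite // edistC finset.setUC.
- move=> x y z; rewrite inE => /andP[xyz vt]; have [j jk e] := fan_triP T3 cF xyz vt.
  apply: (@tri_perm_ind (fun x y z => area Q x y z != 0) v (c j) (c j.+1)) => //.
  + by move=> ? ? ?; rewrite areaC oppr_eq0.
  + by move=> ? ? ?; rewrite areaAC oppr_eq0.
  + exact: T3.
  + by rewrite gt_eqF ?pos.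
have opp a b b' : tri v a b \in T -> tri v a b' \in T -> b != b' ->
    area Q v a b * area Q v a b' < 0.
  move=> vab vab' bb'.
  have [i [j [ik jk ai aj [[-> ->]|[-> ->]]]]] := fan_opposite cF vab vab' bb'.
    by rewrite {1}ai aj [area Q v (c j.+1) _]areaAC mulrN oppr_lt0 mulr_gt0 ?pos.
  by rewrite {2}ai aj [area Q v (c j.+1) _]areaAC mulNr oppr_lt0 mulr_gt0 ?pos.
move=> p q a b; rewrite !inE -!orbA => /andP[pqa va] /andP[pqb vb] ab.
have [pq pa qa] := tri_neq (T3 pqa); have [_ pb qb] := tri_neq (T3 pqb).
(* The common edge contains [v]: otherwise [v] would be the third vertex of both triangles, and
   [a = b]. *)
have : v = p \/ v = q.
  case/or3P: va => /eqP e; [by left|by right|]; move: vb; rewrite e.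
  by rewrite eq_sym (negPf pa) eq_sym (negPf qa) (negPf ab).
case=> e; rewrite -e in pqa pqb *; first exact: opp.
by rewrite areaC [area _ p v b]areaC mulrNN; apply: opp => //; rewrite triC.
Qed.

(** The first triangle fixes the isometry; from there on two distances and the side opposite to the
    previous triangle determine each next neighbour. In a closed fan, [0] and [k] give two
    expressions for one point, which constrains the total angle. *)
Lemma fan_placement P : placed (star T v) l P ->
  exists f, [/\ isom f, f (P v) = 0 &
    forall j, (j <= k)%N -> f (P (c j)) = r j *: expi (S j)].
Proof.
move=> [D1 D2 D3]; have k0 := fan_gt0 cF.
have inS j : (j < k)%N -> tri v (c j) (c j.+1) \in star T v.
  by move=> jk; rewrite inE (fan_tri cF) // !inE eqxx.
have ne j : (j < k)%N -> [/\ v != c j, v != c j.+1 & c j != c j.+1].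
  exact: (fan_neq T3 cF).
have dv j : (j <= k)%N -> edist (P v) (P (c j)) = r j.
  case: j => [|j] jk.
    have [? _ _] := ne _ k0.
    by rewrite (D1 _ _ _ (inS _ k0)) // !inE eqxx ?orbT.
  have [_ ? _] := ne _ jk.
  by rewrite (D1 _ _ _ (inS _ jk)) // !inE eqxx ?orbT.
have dc j : (j < k)%N -> edist (P (c j)) (P (c j.+1)) = l (pair (c j) (c j.+1)).
  move=> jk; have [_ _ ?] := ne _ jk.
  by rewrite (D1 _ _ _ (inS _ jk)) // !inE eqxx ?orbT.
have r0 j : (j <= k)%N -> edist 0 (r j *: expi (S j)) = r j.
  by move=> jk; rewrite edist_expi0 // ltW // fan_radius_gt0.
have [|||f [fi fv f0 f1]] := @isom_exists R (P v) (P (c 0%N)) (P (c 1%N))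
    0 (r 0%N *: expi (S 0%N)) (r 1%N *: expi (S 1%N)) (D2 _ _ _ (inS _ k0)).
- by rewrite dv // r0.
- by rewrite dv // r0.
- by rewrite dc // fan_edge.
exists f; split=> //.
suff H j : (j < k)%N -> f (P (c j)) = r j *: expi (S j) /\
    f (P (c j.+1)) = r j.+1 *: expi (S j.+1).
  by case=> [//|j] jk; have [] := H j jk.
elim: j => // j IH jk; have [e0 e1] := IH (ltnW jk); split=> //.
have jk1 := ltnW jk.
apply: (@third_point R (f (P v)) (f (P (c j.+1)))).
- by rewrite isom_edist // dv // fv r0.
- by rewrite isom_edist // dc // e1 fan_edge.
have j1 := inS _ jk1; rewrite triAC in j1.
have cj : c j != c j.+2.
  apply/eqP => e; have [ci [[k2 ck]|[_ ck]] _] := cF; last first.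
    have [jk2|jk2] := ltnP j.+2 k; first by have := ci _ _ jk1 jk2 e; lia.
    have E : j.+2 = k by apply/eqP; rewrite eqn_leq jk.
    by have := ck _ jk1; rewrite e E eqxx.
  exact: (@fan_no_2cycle _ _ _ _ _ cF j.+1 j).
have := D3 _ _ _ _ j1 (inS _ jk) cj.
rewrite /area -(isom_side _ _ _ _ fi) fv !subr0 e0 e1 crossC mulNr oppr_lt0.
have p1 := fan_cross_gt0 fan_radius_gt0 fan_step jk1.
have p2 := fan_cross_gt0 fan_radius_gt0 fan_step jk.
by rewrite (pmulr_rgt0 _ p1) => p3; rewrite mulr_gt0.
Qed.

End FanPlacement.
End Fixed.
End Placements.

(** * Local systems on a triangulated disk *)

Section Continuity.
Variable R : realType.
Local Open Scope classical_set_scope.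

Lemma coord_le_norm n (x : 'rV[R]_n) i : `|x 0 i| <= `|x|.
Proof.
have /mapP[j Hj ->] : `|x ord0 i| \in [seq `|x ij.1 ij.2| | ij : 'I_1 * 'I_n].
  by apply/mapP; exists (ord0, i) => //=; rewrite mem_enum.
by rewrite [leRHS]/Num.Def.normr /= mx_normrE; apply/bigmax_geP; right => /=; exists j.
Qed.

Lemma norm_le_coord n (x : 'rV[R]_n) e : 0 <= e -> (forall i, `|x 0 i| <= e) -> `|x| <= e.
Proof.
move=> e0 xe; rewrite [leLHS]/Num.Def.normr /= mx_normrE; apply: bigmax_le => //= i _.
by rewrite ord1.
Qed.

Lemma within_continuousP (X Y : normedModType R) (A : set X) (f : X -> Y) :
  {within A, continuous f} <-> forall x, A x -> forall e : R, 0 < e ->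
    exists2 d : R, 0 < d & forall y, A y -> `|x - y| < d -> `|f x - f y| < e.
Proof.
rewrite subspace_continuousP; split => H x Ax.
  move=> e e0; have /cvgrPdist_lt/(_ e e0) := H x Ax.
  rewrite near_withinE => /nbhs_normP[d /= d0 dP]; exists d => // y Ay xy.
  by apply: dP.
apply/cvgrPdist_lt => e e0; have [d d0 dP] := H x Ax e e0.
rewrite near_withinE; apply/nbhs_normP; exists d => // y /= xy Ay; exact: dP.
Qed.

Lemma heine (X Y : normedModType R) (A : set X) (f : X -> Y) :
  compact A -> {within A, continuous f} -> forall e : R, 0 < e ->
  exists2 d : R, 0 < d & forall x y, A x -> A y -> `|x - y| < d -> `|f x - f y| < e.
Proof.
move=> /compact_near_coveringP cA /within_continuousP fc e e0.
(* [A x] is a premise inside [P] because the covering criterion also runs over points near [x]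
   outside [A]. *)
pose P (d : R) (x : X) := forall y, A x -> A y -> `|x - y| < d -> `|f x - f y| < e.
have : \forall d \near 0^'+, A `<=` P d.
  apply: cA => x Ax; have e20 : 0 < e / 2 by rewrite divr_gt0.
  have [d d0 dP] := fc x Ax _ e20; have d20 : 0 < d / 2 by rewrite divr_gt0.
  exists (ball_ Num.Def.normr x (d / 2), [set r | r < d / 2]) => /=.
    by split; [apply/nbhs_normP; exists (d / 2)|exact: nbhs_right_lt].
  move=> [x' r] /= [xx' rd] y Ax' Ay x'y.
  have h1 : `|f x - f x'| < e / 2 by apply: dP => //; lra.
  have h2 : `|f x - f y| < e / 2.
    apply: dP => //; have := ler_normD (x - x') (x' - y).
    by rewrite addrA subrK; lra.
  have := ler_normD (f x' - f x) (f x - f y).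
  by rewrite addrA subrK [`|f x' - f x|]distrC; lra.
move=> nP; have : \forall d \near 0^'+, (0 < d) /\ A `<=` P d.
  by near do split; [exact: nbhs_right_gt|].
move=> /filter_ex[d [d0 dP]]; exists d => // x y Ax Ay; exact: (dP x Ax).
Unshelve. all: by end_near. Qed.

Lemma edist0_scale (y : 'rV[R]_2) (s : R) : 0 <= s -> edist (s *: y) 0 = s * edist y 0.
Proof.
move=> s0; apply/eqP; rewrite -(@eqrXn2 _ 2) ?mulr_ge0 ?edist_ge0 // exprMn !sqr_edist.
by rewrite /dot !mxE; apply/eqP; ring.
Qed.

Lemma disk_scale (y : 'rV[R]_2) (s : R) : 0 <= s <= 1 ->
  closed_unit_disk y -> closed_unit_disk (s *: y).
Proof.
move=> /andP[s0 s1]; rewrite /closed_unit_disk /= edist0_scale // => y1.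
by apply: (le_trans _ y1); rewrite ler_piMl ?edist_ge0.
Qed.

Lemma sqr_edist0 (y : 'rV[R]_2) : edist y 0 ^+ 2 = y 0 0 ^+ 2 + y 0 1 ^+ 2.
Proof. by rewrite sqr_edist subr0 /dot !expr2. Qed.

Lemma norm_disk (y : 'rV[R]_2) : closed_unit_disk y -> `|y| <= 1.
Proof.
rewrite /closed_unit_disk /= -(@ler_pXn2r _ 2) ?nnegrE ?edist_ge0 // expr1n sqr_edist0 => y1.
apply: norm_le_coord => // i; rewrite -(@ler_pXn2r _ 2) ?nnegrE // expr1n.
rewrite real_normK ?num_real //; apply: (le_trans _ y1).
by case: (ord2P i) => ->; rewrite ?lerDl ?lerDr sqr_ge0.
Qed.

Lemma compact_disk : compact (@closed_unit_disk R).
Proof.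
apply: bounded_closed_compact.
  by exists 1; split => // M M1 y /norm_disk y1; exact: le_trans (ltW M1).
have -> : @closed_unit_disk R =
    (fun y : 'rV[R]_2 => y 0 0 * y 0 0 + y 0 1 * y 0 1) @^-1` [set r | r <= 1].
  apply/funext => y; apply/propext; rewrite /closed_unit_disk /= -!expr2 -sqr_edist0.
  by rewrite -[X in _ <-> _ <= X](expr1n R 2) ler_pXn2r ?nnegrE ?edist_ge0.
apply: (preimage_closed _ (@closed_le _ _)) => y _.
have c i : {for y, continuous (fun y : 'rV[R]_2 => y 0 i)} by apply: coord_continuous.
exact: (continuousD (continuousM (c 0) (c 0)) (continuousM (c 1) (c 1))).
Qed.

End Continuity.

(** * From points of the disk to vertices *)

Section LocalSystem.
Variables (R : realType) (n : nat).
Implicit Types (T : {set {set 'I_n}}) (t : {set 'I_n}) (u v w i : 'I_n).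

Lemma simplex_vertex t v : v \in t -> simplex t (@vertex R n v).
Proof.
move=> vt; split=> [i|i it|].
- by rewrite mxE; case: eqP => //= _; rewrite ler0n.
- by rewrite mxE; case: (i =P v) => // e; rewrite e vt in it.
by rewrite (bigD1 v) //= mxE !eqxx big1 ?addr0 // => i iv; rewrite mxE (negPf iv) andbF.
Qed.

Lemma simplex_convex t (x y : 'rV[R]_n) (s : R) : 0 <= s <= 1 -> simplex t x -> simplex t y ->
  simplex t (s *: x + (1 - s) *: y).
Proof.
move=> /andP[s0 s1] [x0 xt x1] [y0 yt y1]; split=> [i|i it|].
- by rewrite !mxE addr_ge0 ?mulr_ge0 ?subr_ge0.
- by rewrite !mxE xt // yt // !mulr0 addr0.
under eq_bigr do rewrite !mxE.
by rewrite big_split /= -!mulr_sumr x1 y1; ring.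
Qed.

Lemma simplex_gt0 t (x : 'rV[R]_n) i : simplex t x -> 0 < x 0 i -> i \in t.
Proof. by case=> _ xt _; apply: contraTT => /xt ->; rewrite ltxx. Qed.

Section Disk.
Variables (T : {set {set 'I_n}}) (f : 'rV[R]_n -> 'rV[R]_2) (g : 'rV[R]_2 -> 'rV[R]_n) (i0 : 'I_n).
Hypotheses (fc : {within realization T, continuous f}%classic)
  (gc : {within @closed_unit_disk R, continuous g}%classic)
  (fg : forall x, realization T x -> closed_unit_disk (f x) /\ g (f x) = x)
  (gf : forall y, closed_unit_disk y -> realization T (g y) /\ f (g y) = y).
Hypothesis T_cover : forall v, exists2 t, t \in T & v \in t.

(* A point is assigned a vertex whose barycentric coordinate is at least [1 / n]. *)
Definition top_coord (x : 'rV[R]_n) : 'I_n := [arg max_(i > i0) x 0 i]%O.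
Let m y := top_coord (g y).

(** The maximum of [n] coordinates with sum [1] is at least their mean. *)
Lemma top_coord_ge t x : simplex t x -> n%:R^-1 <= x 0 (top_coord x).
Proof.
move=> [x0 _ x1]; have n0 : (0 < n)%N := leq_ltn_trans (leq0n i0) (ltn_ord i0).
rewrite /top_coord; case: arg_maxP => // j _ jm.
rewrite -div1r ler_pdivrMr ?ltr0n // -[leLHS]x1.
have -> : x 0 j * n%:R = \sum_(i < n) x 0 j.
  by rewrite sumr_const card_ord mulr_natr.
by apply: ler_sum => i _; apply: jm.
Qed.

Lemma invn_gt0 : 0 < n%:R^-1 :> R.
Proof. by rewrite invr_gt0 ltr0n; exact: leq_ltn_trans (leq0n i0) (ltn_ord i0). Qed.

Lemma top_coord_in t x : simplex t x -> top_coord x \in t.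
Proof.
move=> xt; apply: (simplex_gt0 xt).
exact: lt_le_trans invn_gt0 (top_coord_ge xt).
Qed.

Lemma top_coord_vertex v : top_coord (@vertex R n v) = v.
Proof.
have := top_coord_in (simplex_vertex (finset.set11 v)).
by rewrite finset.in_set1 => /eqP.
Qed.

Lemma realization_simplex t (x : 'rV[R]_n) : t \in T -> simplex t x -> realization T x.
Proof. by move=> tT xt; exists t. Qed.

(** A Lebesgue number: if [g y] and [g y'] differ by less than [1 / n] in each coordinate, then
    [g y] still has a positive coordinate at [m y'], so [m y'] belongs to any triangle containing
    [g y]. *)
Lemma common_triangle : exists2 d : R, 0 < d & forall y, closed_unit_disk y ->
  exists2 t, t \in T & forall y', closed_unit_disk y' -> `|y - y'| < d -> m y' \in t.
Proof.
have [d d0 dP] := heine (@compact_disk R) gc invn_gt0; exists d => // y yD.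
have [[t tT gyt] _] := gf yD; exists t => // y' y'D yy'.
have [[t' t'T gyt'] _] := gf y'D.
apply: (simplex_gt0 gyt); have := top_coord_ge gyt'; rewrite -/(m y').
have := coord_le_norm (g y - g y') (m y'); rewrite !mxE ler_norml.
have := dP y y' yD y'D yy'; lra.
Qed.

(** * Discrete transport along rays, flat inside each triangle by [phi_comp] *)

Section Transport.
Variables (D : Type) (phi : 'I_n -> 'I_n -> D -> D) (d0 : D) (Pr : 'I_n -> D -> Prop).
Hypotheses (phi_comp : forall t u v w d, t \in T -> u \in t -> v \in t -> w \in t ->
    phi v w (phi u v d) = phi u w d)
  (phi_id : forall v d, phi v v d = d)
  (Pr0 : Pr (m 0) d0)
  (Pr_phi : forall t v w d, t \in T -> v \in t -> w \in t -> Pr v d -> Pr w (phi v w d)).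

Variables (e : R) (N : nat).
Hypotheses (e_gt0 : 0 < e) (N_gt0 : (0 < N)%N) (Ne : N%:R^-1 < e / 2).
Hypothesis eP : forall y, closed_unit_disk y ->
  exists2 t, t \in T & forall y', closed_unit_disk y' -> `|y - y'| < e -> m y' \in t.

Let ray (y : 'rV[R]_2) (k : nat) := (k%:R / N%:R) *: y.

Fixpoint transport y k := if k is j.+1 then
  phi (m (ray y j)) (m (ray y j.+1)) (transport y j) else d0.

Let half_lt : e / 2 < e.
Proof. by rewrite ltr_pdivrMr // ltr_pMr // ltr1n. Qed.

Lemma ray_disk y k : (k <= N)%N -> closed_unit_disk y -> closed_unit_disk (ray y k).
Proof.
move=> kN; apply: disk_scale; rewrite divr_ge0 ?ler0n //=.
by rewrite ler_pdivrMr ?ltr0n // mul1r ler_nat.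
Qed.

Lemma ray_step y k : closed_unit_disk y -> `|ray y k - ray y k.+1| < e / 2.
Proof.
move=> /norm_disk y1; apply: le_lt_trans Ne.
rewrite -scalerBl -mulrBl normrZ normrM -natr1 opprD addrA subrr sub0r.
rewrite normrN normr1 mul1r ger0_norm ?invr_ge0 ?ler0n //.
by rewrite ler_piMr // invr_ge0 ler0n.
Qed.

Lemma ray_dist y y' k : (k <= N)%N -> `|ray y k - ray y' k| <= `|y - y'|.
Proof.
move=> kN; rewrite -scalerBr normrZ ger0_norm ?divr_ge0 ?ler0n //.
by rewrite ler_piMl // ler_pdivrMr ?ltr0n // mul1r ler_nat.
Qed.

Lemma ray0 y : ray y 0 = 0.
Proof. by rewrite /ray mul0r scale0r. Qed.

Lemma rayN y : ray y N = y.
Proof. by rewrite /ray divff ?scale1r // pnatr_eq0 -lt0n. Qed.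

(** The four points of the two rays at times [k] and [k.+1] lie within [e] of [ray y k]: at most
    [e / 2] along the ray plus [e / 2] across. Their vertices thus share a triangle, in which
    [phi_comp] makes the square of transitions commute. *)
Lemma transport_near y y' k : closed_unit_disk y -> closed_unit_disk y' ->
  `|y - y'| < e / 2 -> (k <= N)%N ->
  transport y' k = phi (m (ray y k)) (m (ray y' k)) (transport y k).
Proof.
move=> yD y'D yy'; elim: k => [|k IH] kN /=; first by rewrite !ray0 phi_id.
rewrite (IH (ltnW kN)) {IH}.
have [t tT tP] := eP (ray_disk (ltnW kN) yD).
have in0 : m (ray y k) \in t.
  by apply: tP; [apply: ray_disk => //; exact: ltnW|rewrite subrr normr0].
have in1 : m (ray y k.+1) \in t.
  by apply: tP; [exact: ray_disk|exact: lt_trans (ray_step k yD) half_lt].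
have in0' : m (ray y' k) \in t.
  apply: tP; [apply: ray_disk => //; exact: ltnW|].
  exact: le_lt_trans (ray_dist y y' (ltnW kN)) (lt_trans yy' half_lt).
have in1' : m (ray y' k.+1) \in t.
  apply: tP; first exact: ray_disk.
  rewrite -(subrK (ray y k.+1) (ray y k)) -addrA; apply: le_lt_trans (ler_normD _ _) _.
  by rewrite [e]splitr ltrD ?ray_step //; apply: le_lt_trans (ray_dist _ _ kN) _.
by rewrite !(phi_comp _ tT).
Qed.

Lemma Pr_transport y k : closed_unit_disk y -> (k <= N)%N -> Pr (m (ray y k)) (transport y k).
Proof.
move=> yD; elim: k => [|k IH] kN /=; first by rewrite ray0.
have [t tT tP] := eP (ray_disk (ltnW kN) yD).
apply: (Pr_phi tT); last by apply: IH; exact: ltnW.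
  by apply: tP; [apply: ray_disk => //; exact: ltnW|rewrite subrr normr0].
by apply: tP; [exact: ray_disk|exact: lt_trans (ray_step k yD) half_lt].
Qed.

(** The ray ends at the image of the vertex [v], to which [m] assigns [v] itself, so the transported
    value does lie over [v]. *)
Definition section v := transport (f (@vertex R n v)) N.

Lemma realization_vertex v : realization T (@vertex R n v).
Proof.
by have [t tT vt] := T_cover v; exact: realization_simplex tT (simplex_vertex vt).
Qed.

Lemma Pr_section v : Pr v (section v).
Proof.
have [fD fE] := fg (realization_vertex v); have := Pr_transport fD (leqnn N).
by rewrite rayN /m fE top_coord_vertex.
Qed.

(** The end of the ray moves along the image of the segment from [v] to [w] in steps shorter than
    [e / 2]. All vertices assigned on the way belong to [t], so the changes given by
    [transport_near] compose to [phi v w]. *)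
Lemma sectionP t v w : t \in T -> v \in t -> w \in t -> section w = phi v w (section v).
Proof.
move=> tT vt wt.
pose x (s : R) := s *: @vertex R n w + (1 - s) *: @vertex R n v.
have xt s : 0 <= s <= 1 -> simplex t (x s).
  by move=> s01; apply: simplex_convex => //; exact: simplex_vertex.
have xr s : 0 <= s <= 1 -> realization T (x s) by move=> /xt; exact: realization_simplex.
have fxc : {within [set` `[0, 1]%R]%classic, continuous (f \o x)}%classic.
  apply/(within_continuousP (X := R^o)) => s; rewrite /= in_itv /= => s01 e' e'0.
  have [d d_gt0 dP] := (within_continuousP _ _).1 fc (x s) (xr s s01) e' e'0.
  set K := `|@vertex R n w - @vertex R n v|.
  exists (d / (K + 1)); first by rewrite divr_gt0 // ltr_wpDl ?normr_ge0.
  move=> s'; rewrite /= in_itv /= => s'01 ss'; apply: dP; first exact: xr.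
  have -> : x s - x s' = (s - s') *: (@vertex R n w - @vertex R n v).
    by apply/rowP => i; rewrite !mxE; ring.
  rewrite normrZ -/K; have K0 : 0 <= K by exact: normr_ge0.
  have : `|s - s'| * (K + 1) < d by rewrite -ltr_pdivlMr // ltr_wpDl.
  by have := normr_ge0 (s - s'); rewrite mulrDr mulr1; lra.
have e2 : 0 < e / 2 by rewrite divr_gt0.
have [d d_gt0 dP] := heine (X := R^o) (@segment_compact R 0 1) fxc e2.
pose M := (Num.truncn d^-1).+1.
have M0 : 0 < M%:R :> R by rewrite ltr0n.
have Md : M%:R^-1 < d.
  by rewrite invf_plt ?posrE //; exact: truncnS_gt.
pose y j := f (x (j%:R / M%:R)).
have j01 j : (j <= M)%N -> 0 <= (j%:R / M%:R : R) <= 1.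
  by move=> jM; rewrite divr_ge0 ?ler0n // andTb ler_pdivrMr // mul1r ler_nat.
have yD j : (j <= M)%N -> closed_unit_disk (y j).
  by move=> jM; have [] := fg (xr _ (j01 j jM)).
have my j : (j <= M)%N -> m (y j) \in t.
  move=> jM; have [_ fE] := fg (xr _ (j01 j jM)); rewrite /m /y fE.
  exact: top_coord_in (xt _ (j01 j jM)).
have y0 : y 0%N = f (@vertex R n v) by rewrite /y /x mul0r subr0 scale0r add0r scale1r.
have yM : y M = f (@vertex R n w).
  by rewrite /y /x divff ?gt_eqF // subrr scale0r addr0 scale1r.
have mv u : m (f (@vertex R n u)) = u.
  by rewrite /m (fg (realization_vertex u)).2 top_coord_vertex.
suff H j : (j <= M)%N -> transport (y j) N = phi v (m (y j)) (section v).
  by have := H M (leqnn M); rewrite yM mv.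
elim: j => [|j IH] jM; first by rewrite y0 mv phi_id.
have jM' := ltnW jM.
have yy : `|y j - y j.+1| < e / 2; last first.
  rewrite (transport_near (yD j jM') (yD j.+1 jM) yy (leqnn N)) !rayN IH //.
  by rewrite (phi_comp _ tT) ?my.
apply: (dP (j%:R / M%:R) (j.+1%:R / M%:R)); rewrite /= ?in_itv /= ?j01 //.
rewrite -mulrBl normrM -natr1 opprD addrA subrr sub0r normrN normr1 mul1r.
by rewrite gtr0_norm ?invr_gt0.
Qed.

End Transport.
End Disk.

(* Over a disk every local system has a global section: transport along the rays
   from the centre is locally constant, because [g] is uniformly continuous.
   [Pr] is an invariant of the values; with [D := unit] it yields connectedness. *)
Lemma local_system_section T : triangulated_disk R T -> exists v0, forall (D : Type)
    (phi : 'I_n -> 'I_n -> D -> D) (d0 : D) (Pr : 'I_n -> D -> Prop),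
  (forall t u v w d, t \in T -> u \in t -> v \in t -> w \in t ->
    phi v w (phi u v d) = phi u w d) ->
  (forall v d, phi v v d = d) -> Pr v0 d0 ->
  (forall t v w d, t \in T -> v \in t -> w \in t -> Pr v d -> Pr w (phi v w d)) ->
  exists s, (forall t v w, t \in T -> v \in t -> w \in t -> s w = phi v w (s v)) /\
    forall v, Pr v (s v).
Proof.
move=> [[T3 Tl] [f [g [fc gc fg gf]]]].
have T_cover v : exists2 t, t \in T & v \in t.
  have [k [c cF]] : exists k c, fan T v k c.
    case: (Tl v) => [[c /cyclic_link_fan[cF _ _ _]]|[c /path_link_fan[cF _]]];
    by do 2!eexists; exact: cF.
  exists [set v; c 0; c 1]%SET; last by rewrite !inE eqxx.
  exact: (fan_tri cF (fan_gt0 cF)).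
(* [top_coord] needs a default vertex; one exists because the realization contains a point, whose
   coordinates sum to [1]. *)
have [i0 _] : exists i : 'I_n, True.
  have [|[t tT [_ xt x1]] _] := gf 0.
    by rewrite /closed_unit_disk /= edistE subr0 /dot !mxE !mul0r addr0 sqrtr0 ler01.
  apply: contrapT => no; move: x1; rewrite big1 => [/esym/eqP|i _].
    by rewrite oner_eq0.
  by case: no; exists i.
have [e e0 eP] := common_triangle i0 gc gf.
exists (top_coord i0 (g 0)) => D phi d0 Pr phi_comp phi_id Pr0 Pr_phi.
pose N := (Num.truncn (e / 2)^-1).+1.
have Ne : N%:R^-1 < e / 2.
  by rewrite invf_plt ?posrE ?ltr0n ?divr_gt0 //; exact: truncnS_gt.
exists (section f g i0 phi d0 N); split.
  exact: (sectionP fc fg T_cover d0 phi_comp phi_id e0 (ltn0Sn _) Ne eP).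
exact: (Pr_section fg T_cover Pr0 Pr_phi e0 (ltn0Sn _) Ne eP).
Qed.

End LocalSystem.

(** * Gluing and rigidity *)

Section Gluing.
Variables (R : realType) (n : nat) (T : {set {set 'I_n}}) (l : {set 'I_n} -> R).
Implicit Types (t : {set 'I_n}) (a b p q u v w x y z i : 'I_n) (P Q : 'I_n -> 'rV[R]_2).

Local Notation tri a b c := [set a; b; c]%SET.
Local Notation pair a b := [set a; b]%SET.

Hypotheses (T_disk : triangulated_disk R T)
  (l_gt0 : forall e : {set 'I_n}, e \in edges T -> 0 < l e).

Let T3 : forall t, t \in T -> #|t| = 3.
Proof. by have [[]] := T_disk. Qed.

Lemma surface_fan v : exists k c, fan T v k c.
Proof.
have [[_ Tl] _] := T_disk.
case: (Tl v) => [[c /cyclic_link_fan[cF _ _ _]]|[c /path_link_fan[cF _]]];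
by do 2!eexists; exact: cF.
Qed.

Lemma tri_of t : t \in T -> exists x y z, t = tri x y z.
Proof.
move=> tT; have /card_gt0P[x xt] : (0 < #|t|)%N by rewrite T3.
by have [y [z tE]] := triP (T3 tT) xt; exists x, y, z.
Qed.

Lemma tri_star x y z : tri x y z \in T ->
  [/\ tri x y z \in star T x, tri x y z \in star T y & tri x y z \in star T z].
Proof. by move=> xyz; rewrite !inE xyz !eqxx !orbT. Qed.

Lemma isom_eq_on_tri (T' : {set {set 'I_n}}) P (f g : 'rV[R]_2 -> 'rV[R]_2) t : t \in T' -> t \in T -> placed T' l P -> isom f -> isom g ->
  (forall i, i \in t -> f (P i) = g (P i)) -> f = g.
Proof.
move=> tT' tT [_ D2 _] fi gi fg; have [x [y [z tE]]] := tri_of tT.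
rewrite tE in tT' fg; apply: (isom_uniq fi gi (D2 _ _ _ tT')); apply: fg.
- by rewrite !inE eqxx.
- by rewrite !inE eqxx orbT.
- by rewrite !inE eqxx orbT.
Qed.

Lemma placed_tri_isom (T1 T2 : {set {set 'I_n}}) P Q x y z : tri x y z \in T -> tri x y z \in T1 -> tri x y z \in T2 ->
  placed T1 l P -> placed T2 l Q ->
  exists f, [/\ isom f, f (P x) = Q x, f (P y) = Q y & f (P z) = Q z].
Proof.
move=> xyz xyz1 xyz2 [P1 P2 _] [Q1 _ _]; have [xy xz yz] := tri_neq (T3 xyz).
have [xt yt zt] : [/\ x \in tri x y z, y \in tri x y z & z \in tri x y z].
  by rewrite !inE !eqxx !orbT.
by apply: isom_exists; [exact: P2|..]; rewrite (P1 _ _ _ xyz1) // (Q1 _ _ _ xyz2).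
Qed.

(** One common triangle determines the isometry. Any other common triangle lies across the edge
    [v w] from it in both placements, so its third vertex is matched as well, by [third_point]. *)
Lemma star_transition v w P Q : v != w -> placed (star T v) l P -> placed (star T w) l Q ->
  exists2 f, isom f & forall t i, t \in T -> v \in t -> w \in t -> i \in t -> f (P i) = Q i.
Proof.
move=> vw Pv Qw.
have triE t : t \in T -> v \in t -> w \in t -> exists a, t = tri v w a.
  move=> tT vt wt; have [x [y tE]] := triP (T3 tT) vt.
  move: wt; rewrite tE !inE eq_sym (negPf vw) /= => /orP[]/eqP ->.
    by exists y.
  by exists x; rewrite triAC.
have [[t [tT vt wt]]|no] := pselect (exists t, [/\ t \in T, v \in t & w \in t]); last first.
  by exists id => [|t i tT vt wt]; [exact: isom_id|case: no; exists t].
have [a tE] := triE t tT vt wt; rewrite {}tE in tT {vt wt}.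
have [tv tw _] := tri_star tT.
have [f [fi fv fw fa]] := placed_tri_isom tT tv tw Pv Qw.
exists f => // t' i t'T vt' wt' it'; have [b tE'] := triE t' t'T vt' wt'.
rewrite {}tE' in t'T it' {vt' wt'}.
have [E|ab] := eqVneq a b.
  by move: it'; rewrite -E !inE -orbA => /or3P[]/eqP ->.
move: it'; rewrite !inE -orbA => /or3P[]/eqP -> //.
have [_ vb wb] := tri_neq (T3 t'T).
have [t'v t'w _] := tri_star t'T.
have [P1 _ P3] := Pv; have [Q1 _ Q3] := Qw.
have [vt' wt' bt'] : [/\ v \in tri v w b, w \in tri v w b & b \in tri v w b].
  by rewrite !inE !eqxx !orbT.
apply: (@third_point R (Q v) (Q w)).
- by rewrite -fv isom_edist // fv (P1 _ _ _ t'v) // (Q1 _ _ _ t'w).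
- by rewrite -fw isom_edist // fw (P1 _ _ _ t'v) // (Q1 _ _ _ t'w).
have := P3 _ _ _ _ tv t'v ab; have := Q3 _ _ _ _ tw t'w ab.
rewrite /area -(isom_side (P v) (P w) (P a) (P b) fi) fv fw fa.
set A := cross _ (Q a - _); set B := cross _ (Q b - _); set C := cross _ (f _ - _).
move=> AB AC; have : 0 < (A * C) * (A * B) by rewrite nmulr_rgt0.
have -> : (A * C) * (A * B) = A ^+ 2 * (C * B) by ring.
have A2 : 0 < A ^+ 2.
  by rewrite lt_neqAle sqr_ge0 andbT eq_sym sqrf_eq0; apply: contraTneq AB => ->; rewrite mul0r ltxx.
by rewrite pmulr_rgt0.
Qed.

(** The value over [v] is an isometry carrying the chosen placement [Q v] into a common plane;
    passing to [w] precomposes it with the transition from [Q w] to [Q v]. *)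
Lemma placed_exists : (forall v, exists Q, placed (star T v) l Q) -> exists P, placed T l P.
Proof.
move=> /choice[Q QP].
have : forall vw : 'I_n * 'I_n, exists f, isom f /\ forall t i,
    t \in T -> vw.1 \in t -> vw.2 \in t -> i \in t -> f (Q vw.1 i) = Q vw.2 i.
  move=> [v w] /=; have [<-|vw] := eqVneq v w.
    by exists id; split; [exact: isom_id|].
  by have [f fi fP] := star_transition vw (QP v) (QP w); exists f.
move=> /choice[h hP]; pose g v w := h (v, w).
have gi v w : isom (g v w) by have [] := hP (v, w).
have gP v w t i : t \in T -> v \in t -> w \in t -> i \in t -> g v w (Q v i) = Q w i.
  by have [_] := hP (v, w); apply.
have in_star v t : t \in T -> v \in t -> t \in star T v by rewrite inE => -> ->.
have [v0 sec] := local_system_section T_disk.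
have [| | | |s [sE si]] := sec _ (fun v w d => d \o g w v) id (fun _ d => isom d).
- move=> t u v w d tT ut vt wt; apply/funext => x /=; congr d.
  have -> // : g w u = g v u \o g w v.
  apply: (isom_eq_on_tri (in_star w t tT wt) tT (QP w)) => //.
    exact: isom_comp.
  by move=> i it /=; rewrite !(gP _ _ t).
- move=> v d; apply/funext => x /=; congr d; have -> // : g v v = id.
  have [k [c cF]] := surface_fan v; have vt := fan_tri cF (fan_gt0 cF).
  have vvt : v \in tri v (c 0%N) (c 1%N) by rewrite !inE eqxx.
  apply: (isom_eq_on_tri (in_star _ _ vt vvt) vt (QP v)) => //; first exact: isom_id.
  by move=> i it; rewrite (gP _ _ _ i vt).
- exact: isom_id.
- by move=> t v w d _ _ _ di; apply: isom_comp.
(* A vertex may be located through the star of any vertex of a common triangle; each clause of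
   [placed] thus reduces to a single star. *)
have PE t v i : t \in T -> v \in t -> i \in t -> s i (Q i i) = s v (Q v i).
  by move=> tT vt it; rewrite (sE t i v) //= (gP _ _ t).
exists (fun i => s i (Q i i)); split.
- move=> t p q tT pt qt pq; rewrite (PE t p q) // isom_edist //.
  by have [D1 _ _] := QP p; apply: D1 (in_star _ _ tT pt) _ _ _.
- move=> x y z xyz; have [xs _ _] := tri_star xyz.
  rewrite /area (PE _ x y xyz) ?(PE _ x z xyz) ?inE ?eqxx ?orbT //.
  by rewrite isom_cross_neq0 //; have [_ D2 _] := QP x; apply: D2.
move=> p q a b pqa pqb ab; have [sa _ _] := tri_star pqa; have [sb _ _] := tri_star pqb.
rewrite /area (PE _ p q pqa) ?(PE _ p a pqa) ?(PE _ p b pqb) ?inE ?eqxx ?orbT //.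
by rewrite isom_side //; have [_ _ D3] := QP p; apply: D3.
Qed.

Lemma star_sub v : star T v \subset T.
Proof. by apply/fintype.subsetP => t; rewrite inE => /andP[]. Qed.

(** On each star both placements have the normal form of [fan_placement], so an isometry relates
    them. Isometries for adjacent stars agree on a common triangle and are equal; connectedness then
    propagates a single [f]. *)
Lemma placed_uniq P Q : placed T l P -> placed T l Q ->
  exists2 f, isom f & forall i, f (P i) = Q i.
Proof.
move=> PP QP; have ti := placed_tri_ineq T3 PP.
have star_isom v : exists2 f, isom f &
    forall t i, t \in T -> v \in t -> i \in t -> f (P i) = Q i.
  have [k [c cF]] := surface_fan v.
  have [f [fi fv fc]] := fan_placement T3 l_gt0 cF ti (placed_sub (star_sub v) PP).
  have [g [gi gv gc]] := fan_placement T3 l_gt0 cF ti (placed_sub (star_sub v) QP).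
  have [h hi gK] := isom_inv gi; exists (h \o f); first exact: isom_comp.
  move=> t i tT vt; have [j jk ->] := fan_triP T3 cF tT vt.
  rewrite !inE -orbA => /or3P[]/eqP -> /=.
  - by rewrite fv -gv gK.
  - by rewrite fc ?(ltnW jk) // -gc ?(ltnW jk) // gK.
  - by rewrite fc // -gc // gK.
have [v0 sec] := local_system_section T_disk.
have [f fi f0] := star_isom v0; exists f => // i.
have [| | | |_ [_ /(_ i) fP]] := sec unit (fun _ _ => id) tt
    (fun v _ => forall t i, t \in T -> v \in t -> i \in t -> f (P i) = Q i) => //.
  move=> t v w _ tT vt wt fv; have [g gi gw] := star_isom w.
  suff -> : f = g by [].
  apply: (isom_eq_on_tri tT tT PP) => // j jt.
  by rewrite (fv t) // (gw t).
have [k [c cF]] := surface_fan i; have vt := fan_tri cF (fan_gt0 cF).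
by apply: fP vt _ _; rewrite !inE eqxx.
Qed.

End Gluing.

(** * Developments and placements *)

Section PiecewiseLinear.
Variables (R : realType) (n : nat).
Implicit Types (T : {set {set 'I_n}}) (t : {set 'I_n}) (a b p q u v i : 'I_n)
  (P Q : 'I_n -> 'rV[R]_2) (x y z : 'rV[R]_n) (s r : R).

Local Notation tri a b c := [set a; b; c]%SET.
Local Notation pair a b := [set a; b]%SET.

(** A linear map on the whole ambient space, so continuity and affinity on simplices are
    immediate. *)
Definition ext P x : 'rV[R]_2 := \sum_i x 0 i *: P i.

Lemma ext_vertex P i : ext P (vertex R i) = P i.
Proof.
rewrite /ext (bigD1 i) //= mxE !eqxx scale1r big1 ?addr0 // => j ji.
by rewrite mxE (negPf ji) andbF scale0r.
Qed.

Lemma extD P x y : ext P (x + y) = ext P x + ext P y.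
Proof. by rewrite /ext -big_split; apply: eq_bigr => i _ /=; rewrite mxE scalerDl. Qed.

Lemma extZ P s x : ext P (s *: x) = s *: ext P x.
Proof. by rewrite /ext scaler_sumr; apply: eq_bigr => i _; rewrite mxE scalerA. Qed.

Lemma extB P x y : ext P (x - y) = ext P x - ext P y.
Proof. by rewrite -scaleN1r extD extZ scaleN1r. Qed.

Lemma ext_isom f P x : isom f -> \sum_i x 0 i = 1 -> f (ext P x) = ext (f \o P) x.
Proof.
move=> [M [c [_ fE]]] x1; rewrite fE /ext mulmx_suml.
under [RHS]eq_bigr do rewrite /= fE scalerDr.
rewrite big_split /= -scaler_suml x1 scale1r; congr (_ + _).
by apply: eq_bigr => i _; rewrite scalemxAl.
Qed.

Lemma norm_ext P x : `|ext P x| <= `|x| * \sum_i `|P i|.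
Proof.
apply: (le_trans (ler_norm_sum _ _ _)); rewrite mulr_sumr; apply: ler_sum => i _.
by rewrite normrZ ler_wpM2r // coord_le_norm.
Qed.

Lemma ext_continuous (A : set 'rV[R]_n) P : {within A, continuous (ext P)}%classic.
Proof.
apply/within_continuousP => x _ e e0; set K := \sum_i `|P i|.
have K0 : 0 <= K by apply: sumr_ge0.
exists (e / (K + 1)); first by rewrite divr_gt0 // ltr_wpDl.
move=> y _ xy; rewrite -extB; apply: (le_lt_trans (norm_ext _ _)).
have : `|x - y| * (K + 1) < e by rewrite -ltr_pdivlMr // ltr_wpDl.
by apply: le_lt_trans; rewrite ler_wpM2l // lerDl.
Qed.

Lemma sum_tri (V : zmodType) (F : 'I_n -> V) a b c : #|tri a b c| = 3 ->
  (forall i, i \notin tri a b c -> F i = 0) -> \sum_i F i = F a + F b + F c.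
Proof.
move=> /tri_neq[ab ac bc] F0; rewrite (bigD1 a) // (bigD1 b) /= 1?eq_sym //.
rewrite (bigD1 c) /=; last by rewrite eq_sym ac eq_sym bc.
rewrite big1 ?addr0 ?addrA // => i /andP[/andP[ia ib] ic].
by apply: F0; rewrite !inE (negPf ia) (negPf ib) (negPf ic).
Qed.

Lemma simplex_sum a b c x : #|tri a b c| = 3 -> simplex (tri a b c) x ->
  x 0 a + x 0 b + x 0 c = 1.
Proof. by move=> t3 [_ xt <-]; rewrite (sum_tri t3). Qed.

Lemma ext_tri P a b c x : #|tri a b c| = 3 -> simplex (tri a b c) x ->
  ext P x - P a = x 0 b *: (P b - P a) + x 0 c *: (P c - P a).
Proof.
move=> t3 xt; have := simplex_sum t3 xt; case: xt => _ xt _ x1.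
rewrite /ext (sum_tri t3) => [|i /xt ->]; last by rewrite scale0r.
rewrite -[P a in X in _ - X](scale1r) -x1 !scalerDl !scalerBr.
by apply/rowP => i; rewrite !mxE; ring.
Qed.

Lemma simplex_eq v x y : \sum_i x 0 i = 1 -> \sum_i y 0 i = 1 ->
  (forall i, i != v -> x 0 i = y 0 i) -> x = y.
Proof.
move=> x1 y1 xy; apply/rowP => i; have [->|] := eqVneq i v; last exact: xy.
move: x1; rewrite -y1 (bigD1 v) //= [in RHS](bigD1 v) //=.
by rewrite (eq_bigr (fun i => y 0 i)) // => /addIr.
Qed.

Lemma ext_inj_tri P a b c x y : #|tri a b c| = 3 -> area P a b c != 0 ->
  simplex (tri a b c) x -> simplex (tri a b c) y -> ext P x = ext P y -> x = y.
Proof.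
move=> t3 nz xt yt e.
have [eb ec] : x 0 b = y 0 b /\ x 0 c = y 0 c.
  by apply: (lin_comb_uniq nz); rewrite -!ext_tri // e.
case: xt yt => _ xt x1 [_ yt y1]; apply: (@simplex_eq a) => // i ia.
have [it|it] := boolP (i \in tri a b c); last by rewrite xt ?yt.
by move: it; rewrite !inE (negPf ia) /= => /orP[]/eqP ->.
Qed.

Definition bary a b c s r : 'rV[R]_n :=
  (1 - s - r) *: vertex R a + s *: vertex R b + r *: vertex R c.

Lemma baryE a b c s r i : bary a b c s r 0 i =
  (1 - s - r) * (i == a)%:R + s * (i == b)%:R + r * (i == c)%:R.
Proof. by rewrite !mxE. Qed.

Lemma bary_simplex a b c s r : 0 <= s -> 0 <= r -> s + r <= 1 ->
  simplex (tri a b c) (bary a b c s r).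
Proof.
move=> s0 r0 sr; split=> [i|i|].
- by rewrite baryE !addr_ge0 ?mulr_ge0 ?ler0n //; lra.
- by rewrite !inE !negb_or baryE -andbA => /and3P[/negPf -> /negPf -> /negPf ->];
  by rewrite /= !mulr0 !addr0.
have D k : \sum_i (i == k)%:R = 1 :> R.
  by rewrite (bigD1 k) //= eqxx big1 ?addr0 // => i /negPf ->.
under eq_bigr do rewrite baryE.
by rewrite !big_split /= -!mulr_sumr !D; ring.
Qed.

Lemma ext_bary P a b c s r :
  ext P (bary a b c s r) = P a + s *: (P b - P a) + r *: (P c - P a).
Proof.
by rewrite /bary !extD !extZ !ext_vertex; apply/rowP => i; rewrite !mxE; ring.
Qed.

Lemma bary_inj a b c s r s' r' : #|tri a b c| = 3 ->
  bary a b c s r = bary a b c s' r' -> s = s' /\ r = r'.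
Proof.
move=> /tri_neq[ab ac bc] e.
have B s1 r1 : bary a b c s1 r1 0 b = s1.
  by rewrite baryE eqxx eq_sym (negPf ab) (negPf bc) /=; ring.
have C s1 r1 : bary a b c s1 r1 0 c = r1.
  by rewrite baryE eqxx ![c == _]eq_sym (negPf ac) (negPf bc) /=; ring.
by split; [rewrite -(B s r) e B|rewrite -(C s r) e C].
Qed.

Lemma cross0_line (u w : 'rV[R]_2) : cross u w = 0 -> w != 0 -> exists k, u = k *: w.
Proof.
move=> c0 w0; have ww : dot w w != 0 by apply: contraNneq w0 => /dot0_eq0 ->.
exists (dot w u / dot w w); apply: (eq_from_dot_cross w0).
  transitivity (dot w u / dot w w * dot w w); first by rewrite divfK.
  by rewrite /dot !mxE; ring.
rewrite crossC c0 /cross !mxE; ring.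
Qed.

Lemma area_neq0 P a b c : #|tri a b c| = 3 -> set_inj (simplex (tri a b c)) (ext P) ->
  area P a b c != 0.
Proof.
move=> t3 inj; apply/eqP => ar0.
have H s r s' r' :
    s *: (P b - P a) + r *: (P c - P a) = s' *: (P b - P a) + r' *: (P c - P a) ->
    0 <= s -> 0 <= r -> s + r <= 1 -> 0 <= s' -> 0 <= r' -> s' + r' <= 1 ->
    s = s' /\ r = r'.
  move=> e *; apply: (bary_inj t3); apply: inj.
  - by apply/mem_set/bary_simplex.
  - by apply/mem_set/bary_simplex.
  - by rewrite !ext_bary -!addrA e.
have [w0|w0] := eqVneq (P c - P a) 0.
  by have [] := H 0 0 0 1; rewrite ?w0 ?scaler0 //; lra.
have [k uE] := cross0_line ar0 w0.
(* Since [P b - P a = k *: (P c - P a)], moving the coordinates by [(e, - k * e)] leaves the image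
   fixed. This [e] keeps both changes within [1 / 6], so the point moved from the centroid stays in
   the triangle. *)
pose e := (6 * (1 + `|k|))^-1; have k0 := normr_ge0 k.
have e0 : 0 < e by rewrite invr_gt0; lra.
have ke : `|k * e| <= 1 / 6.
  by rewrite normrM (gtr0_norm e0) /e ler_pdivrMr; lra.
have e6 : e <= 1 / 6 by rewrite /e -[leLHS]mul1r ler_pdivrMr; lra.
move: ke; rewrite ler_norml => ke.
have [] := H (1 / 3) (1 / 3) (1 / 3 + e) (1 / 3 - k * e).
  by rewrite uE !scalerA -!scalerDl; congr (_ *: _); ring.
all: lra.
Qed.

Lemma nbhs_bary a b c s r (U : set 'rV[R]_n) (al be : R) : nbhs (bary a b c s r) U ->
  exists2 d : R, 0 < d & forall e, 0 < e < d -> U (bary a b c (s + e * al) (r + e * be)).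
Proof.
move=> /nbhs_normP[d /= d0 dU].
pose D := al *: (vertex R b - vertex R a) + be *: (vertex R c - vertex R a).
have D0 : 0 <= `|D| by exact: normr_ge0.
exists (d / (`|D| + 1)); first by rewrite divr_gt0 // ltr_wpDl.
move=> e /andP[e0 ed]; apply: dU => /=.
have -> : bary a b c s r - bary a b c (s + e * al) (r + e * be) = (- e) *: D.
  by apply/rowP => i; rewrite !mxE; ring.
rewrite normrZ normrN gtr0_norm //.
have : e * (`|D| + 1) < d by rewrite -ltr_pdivlMr // ltr_wpDl.
by apply: le_lt_trans; rewrite ler_wpM2l ?lerDl // ltW.
Qed.

(** [affine_on] concerns two points at a time, so a vertex [i] is split off: [x] lies on the segment
    from [i] to a point [y] of the opposite face, and induction applies to [y]. The case [x 0 i = 1]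
    is apart because [y] is obtained by dividing by [1 - x 0 i]. *)
Lemma affine_ext t phi : affine_on (simplex t) phi ->
  forall x, simplex t x -> phi x = ext (fun i => phi (vertex R i)) x.
Proof.
move=> aff x xt.
suff H m : forall s : {set 'I_n}, #|s| = m -> s \subset t -> forall x, simplex s x ->
  phi x = ext (fun i => phi (vertex R i)) x by exact: (H _ t erefl (subxx t)).
elim: m => [|m IH] s sm st {x xt} x [x0 xs x1].
  move: x1; rewrite big1 => [/esym/eqP|i _]; first by rewrite oner_eq0.
  by apply: xs; rewrite (finset.cards0_eq sm) inE.
have [i is_] : exists i, i \in s by apply/card_gt0P; rewrite sm.
have sti : (s :\ i)%SET \subset t by exact: fintype.subset_trans (finset.subD1set _ _) st.
have smi : #|(s :\ i)%SET| = m by move: sm; rewrite (cardsD1 i) is_ => -[].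
have xsum : x 0 i + \sum_(j | j != i) x 0 j = 1 by rewrite -x1 [RHS](bigD1 i).
have xi1 : x 0 i <= 1 by rewrite -xsum lerDl sumr_ge0.
have [xi|xi] := eqVneq (x 0 i) 1.
  have -> : x = vertex R i.
    apply: (@simplex_eq i) => //.
      by have [] := @simplex_vertex R n [set i]%SET i (finset.set11 i).
    move=> j ji; rewrite mxE (negPf ji) andbF.
    have /psumr_eq0P z : \sum_(j | j != i) x 0 j = 0 by rewrite xi in xsum; lra.
    by apply: z.
  by rewrite ext_vertex.
have r0 : 0 < 1 - x 0 i by rewrite subr_gt0 lt_neqAle xi.
pose y := (1 - x 0 i)^-1 *: (x - x 0 i *: vertex R i).
have yE j : y 0 j = (1 - x 0 i)^-1 * (x 0 j - x 0 i * (j == i)%:R) by rewrite !mxE.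
have ys : simplex (s :\ i)%SET y.
  split=> [j|j|].
  - rewrite yE mulr_ge0 ?invr_ge0 ?(ltW r0) //.
    by have [->|_] := eqVneq j i; rewrite ?mulr1 ?subrr // mulr0 subr0.
  - rewrite !inE negb_and negbK yE => /orP[/eqP ->|js].
      by rewrite eqxx mulr1 subrr mulr0.
    have ji : j != i by apply: contraNneq js => ->.
    by rewrite (xs j js) (negPf ji) mulr0 subr0 mulr0.
  under eq_bigr do rewrite yE.
  rewrite -mulr_sumr big_split /= x1 sumrN -mulr_sumr.
  rewrite (bigD1 i) //= eqxx big1 => [|j /negPf -> //].
  by rewrite addr0 mulr1 mulVf // gt_eqF.
have xE : x = x 0 i *: vertex R i + (1 - x 0 i) *: y.
  by rewrite scalerA divff ?gt_eqF // scale1r subrKC.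
have yt : simplex t y.
  case: ys => y0 ysi y1; split=> // j jt; apply: ysi.
  by apply: contra jt; exact: (fintype.subsetP sti).
rewrite {1}xE aff //; last 2 first.
- by apply: simplex_vertex; exact: (fintype.subsetP st).
- by rewrite x0 xi1.
by rewrite (IH _ smi sti y ys) [in RHS]xE extD !extZ ext_vertex.
Qed.

End PiecewiseLinear.

(** * From developments to placements and zero curvature *)

Section Development.
Variables (R : realType) (n : nat) (T : {set {set 'I_n}}) (l : {set 'I_n} -> R).
Implicit Types (t e : {set 'I_n}) (a b p q u v i : 'I_n)
  (P Q : 'I_n -> 'rV[R]_2) (x y z : 'rV[R]_n).

Local Notation tri a b c := [set a; b; c]%SET.
Local Notation pair a b := [set a; b]%SET.

Hypotheses (T_disk : triangulated_disk R T)
  (l_gt0 : forall e : {set 'I_n}, e \in edges T -> 0 < l e).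

Let T3 : forall t, t \in T -> #|t| = 3.
Proof. by have [[]] := T_disk. Qed.

Definition locally_injective P := forall x, (realization T `\` boundary T)%classic x ->
  exists2 U, nbhs x U & set_inj (realization T `&` U)%classic (ext P).

Definition flat := forall v s, interior_vertex T v -> cyclic_link T v s -> curvature l v s = 0.

(** If both triangles were on the same side of the edge, a small step from its midpoint into the
    first would have the same image as a small step into the second, contradicting local injectivity
    there. *)
Lemma tri_opposite P p q a b : locally_injective P -> tri p q a \in T -> tri p q b \in T ->
  a != b -> area P p q a != 0 -> area P p q b != 0 -> area P p q a * area P p q b < 0.
Proof.
move=> inj pqa pqb ab na nb; rewrite lt_neqAle mulf_neq0 //= leNgt; apply/negP => pos.
have ta := T3 pqa; have tb := T3 pqb; have [pq pa qa] := tri_neq ta; have [_ pb qb] := tri_neq tb.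
have mE : bary p q a (1 / 2) 0 = bary p q b (1 / 2) 0 :> 'rV[R]_n.
  by apply/rowP => i; rewrite !baryE; ring.
(* The midpoint is not on the boundary: a boundary edge through it would be [p q], which lies in two
   triangles. *)
have [|U Um Uinj] := inj (bary p q a (1 / 2) 0).
  split; first by exists (tri p q a) => //; apply: bary_simplex; lra.
  move=> [e /= eB me].
  have pe : p \in e.
    apply: (simplex_gt0 me); rewrite baryE eqxx (negPf pq) (negPf pa) /=.
    by rewrite !mulr0 !addr0 mulr1; lra.
  have qe : q \in e.
    apply: (simplex_gt0 me); rewrite baryE eqxx eq_sym (negPf pq) (negPf qa) /=.
    by rewrite !mulr0 add0r addr0 mulr1; lra.
  move: eB; rewrite !inE => /andP[/andP[e2 _] /cards1P[t tE]].
  have ee : e = pair p q.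
    apply/esym/eqP; rewrite eqEcard finset.subUset !finset.sub1set pe qe.
    by rewrite cards2 pq (eqP e2).
  have int c : tri p q c \in T -> tri p q c = t.
    by move=> pqc; apply/eqP; rewrite -finset.in_set1 -tE inE pqc ee finset.subsetUl.
  have E : tri p q a = tri p q b by rewrite (int a) // (int b).
  have : tri p q a = tri p q b -> a = b by exact: tri_inj.
  by move=> /(_ E) E'; rewrite E' eqxx in ab.
pose A := area P p q a; pose B := area P p q b.
(* [mu] and [nu] are the coordinates of the direction of [a] in the frame of the second triangle;
   [nu > 0] means that this direction points into it. *)
pose nu := A / B; have nu0 : 0 < nu.
  have B2 : 0 < B ^+ 2 by rewrite lt_neqAle sqr_ge0 andbT eq_sym sqrf_eq0.
  rewrite -(pmulr_lgt0 _ B2); suff -> : nu * B ^+ 2 = A * B by [].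
  by rewrite /nu expr2 mulrA divfK.
pose mu := cross (P a - P p) (P b - P p) / B.
have aE : P a - P p = mu *: (P q - P p) + nu *: (P b - P p).
  apply: (scalerI nb); rewrite [RHS]scalerDr !scalerA mulrCA divff // mulr1 mulrCA divff // mulr1.
  by apply: row2P; rewrite /A /area /cross !mxE; ring.
have [d1 d10 D1] := nbhs_bary 0 1 Um.
rewrite mE in Um; have [d2 d20 D2] := nbhs_bary mu nu Um.
(* With [e * K <= 1] the steps change the coordinates by at most [1 / 4] in total, so both points
   remain in their triangles. *)
pose K := 4 * (1 + `|mu| + nu).
have mu0 : 0 <= `|mu| by exact: normr_ge0.
pose e := Num.min (Num.min (d1 / 2) (d2 / 2)) K^-1.
have K0 : 0 < K^-1 by rewrite invr_gt0 /K; lra.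
have e0 : 0 < e by rewrite !lt_min !divr_gt0.
have ed1 : e <= d1 / 2 by rewrite !ge_min lexx.
have ed2 : e <= d2 / 2 by rewrite !ge_min lexx orbT.
have eK : e * K <= 1.
  by rewrite -ler_pdivlMr; [rewrite div1r !ge_min lexx !orbT|rewrite -invr_gt0].
have emu : `|e * mu| = e * `|mu| by rewrite normrM gtr0_norm.
have enu0 : 0 < e * nu by rewrite mulr_gt0.
have eKE : 4 * e + 4 * (e * `|mu|) + 4 * (e * nu) <= 1.
  by apply: le_trans eK; rewrite le_eqVlt; apply/orP; left; apply/eqP; rewrite /K; ring.
have emu0 : 0 <= e * `|mu| by rewrite mulr_ge0 // ltW.
have := ler_norm (e * mu); have := ler_norm (- (e * mu)); rewrite normrN emu => m1 m2.
have xr : realization T (bary p q a (1 / 2 + e * 0) (0 + e * 1)).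
  by exists (tri p q a) => //; apply: bary_simplex; rewrite ?mulr0 ?mulr1; lra.
have yr : realization T (bary p q b (1 / 2 + e * mu) (0 + e * nu)).
  by exists (tri p q b) => //; apply: bary_simplex; lra.
have : bary p q a (1 / 2 + e * 0) (0 + e * 1) = bary p q b (1 / 2 + e * mu) (0 + e * nu).
  apply: Uinj.
  - by apply/mem_set; split=> //; apply: D1; lra.
  - by apply/mem_set; split=> //; apply: D2; lra.
  - by rewrite !ext_bary aE; apply/rowP => i; rewrite !mxE; ring.
move/rowP/(_ a); rewrite !baryE eqxx ![a == _]eq_sym.
by rewrite (negPf pa) (negPf qa) [b == a]eq_sym (negPf ab) /=; lra.
Qed.

Lemma development_ext phi : nondegenerate_development T l phi ->
  forall x, realization T x -> phi x = ext (fun i => phi (vertex R i)) x.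
Proof.
by move=> [_ aff _ _] x [t tT xt]; have [/affine_ext H _] := aff t tT; exact: H.
Qed.

Lemma development_placed phi : nondegenerate_development T l phi ->
  placed T l (fun i => phi (vertex R i)) /\ locally_injective (fun i => phi (vertex R i)).
Proof.
move=> dev; have phiE := development_ext dev; have [_ aff linj len] := dev.
set P := fun i => _ in phiE *.
have LI : locally_injective P.
  move=> x /linj[U Ux inj]; exists U => // y z yU zU; have [yr _] := set_mem yU.
  by have [zr _] := set_mem zU; rewrite -!phiE //; exact: inj.
have D2 p q a : tri p q a \in T -> area P p q a != 0.
  move=> xyz; apply: area_neq0; first exact: T3.
  have [_ inj] := aff _ xyz; move=> u w ut wt.
  have real x : x \in simplex (tri p q a) -> realization T x.
    by move=> /set_mem xt; exists (tri p q a).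
  by rewrite -!phiE; [exact: inj|exact: real|exact: real].
split=> //; split=> //.
  move=> t p q tT pt qt pq; apply: len; rewrite inE cards2 pq eqxx.
  by apply/existsP; exists t; rewrite tT finset.subUset !finset.sub1set pt qt.
move=> p q a b pqa pqb ab.
by apply: tri_opposite => //; exact: D2.
Qed.

Lemma curvature_fan v s : cyclic_link T v s ->
  curvature l v s = fan_sum l v (fun j => nth v s (j %% size s)) (size s) - 2 * pi.
Proof.
move=> /cyclic_link_fan[_ _ nx nE]; rewrite /curvature /fan_sum (big_nth v) big_mkord.
congr (_ - _); apply: eq_bigr => j _; rewrite /fan_angle nE //.
by rewrite -nx.
Qed.

Lemma vertex_notin_boundary v : interior_vertex T v -> ~ boundary T (vertex R v).
Proof.
move=> /forallP vi [e /= eB ve]; have /implyP/(_ eB) := vi e.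
by apply/negP; rewrite negbK; apply: (simplex_gt0 ve); rewrite mxE !eqxx.
Qed.

Lemma vertex_bary v a b : vertex R v = bary v a b 0 0.
Proof. by rewrite /bary !scale0r !subr0 !addr0 scale1r. Qed.

(** Closing up gives [cos (S k) = 1]. From [4 pi] on, [fan_overlap] gives a common point of two
    sectors, and scaling toward [v] brings it into any neighbourhood of [v]. *)
Lemma placed_flat P : placed T l P -> locally_injective P -> flat.
Proof.
move=> PP inj v s vi sl; rewrite (curvature_fan sl).
set k := size s; set c := fun j => _.
have cF : fan T v k c by have [] := cyclic_link_fan sl.
have ck : c k = c 0%N by have [] := cyclic_link_fan sl.
have ti := placed_tri_ineq T3 PP; have k0 := fan_gt0 cF.
have [f [fi fv fc]] := fan_placement T3 l_gt0 cF ti (placed_sub (star_sub T v) PP).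
have rgt := fan_radius_gt0 T3 l_gt0 cF; have stp := fan_step T3 l_gt0 cF ti.
set S := fan_sum l v c in fc stp *; have S0 : S 0%N = 0 by exact: fan_sum0.
have Sk0 : 0 < S k by rewrite -S0; apply: (S_mono stp).
have cosk : cos (S k) = 1.
  have := fc k (leqnn k); rewrite ck fc // => /(expi_eq (rgt _ (leq0n k)) (rgt _ (leq0n k)))[_].
  by rewrite S0 subr0.
have [lt|ge] := ltP (S k) (4 * pi).
  by rewrite (cos_eq1_4pi _ cosk) ?subrr // Sk0.
have [j [a [b [a' [b' [/andP[j0 jk] a0 b0 a'0 [b'0 e]]]]]]] := fan_overlap rgt S0 stp ge.
have k2 := closed_fan_gt2 cF ck; have [ci _ _] := cF.
have t0 := fan_tri cF k0; have tj := fan_tri cF jk.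
have [|U Uv Uinj] := inj (vertex R v).
  split; last exact: vertex_notin_boundary.
  by exists (tri v (c 0%N) (c 1%N)) => //; apply: simplex_vertex; rewrite !inE eqxx.
have U1 := Uv; rewrite (vertex_bary v (c 0%N) (c 1%N)) in U1.
rewrite (vertex_bary v (c j) (c j.+1)) in Uv.
have [d1 d10 D1] := nbhs_bary a b U1; have [d2 d20 D2] := nbhs_bary a' b' Uv.
pose K := a + b + a' + b'.
pose r := Num.min (Num.min (d1 / 2) (d2 / 2)) K^-1.
have K0 : 0 < K^-1 by rewrite invr_gt0 !addr_gt0.
have r0 : 0 < r by rewrite !lt_min !divr_gt0.
have rd1 : r <= d1 / 2 by rewrite !ge_min lexx.
have rd2 : r <= d2 / 2 by rewrite !ge_min lexx orbT.
have rK : r * K <= 1.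
  by rewrite -ler_pdivlMr; [rewrite div1r !ge_min lexx !orbT|rewrite -invr_gt0].
have ra := mulr_gt0 r0 a0; have rb := mulr_gt0 r0 b0.
have ra' := mulr_gt0 r0 a'0; have rb' := mulr_gt0 r0 b'0.
have rKE : r * a + r * b + r * a' + r * b' <= 1 by move: rK; rewrite /K !mulrDr.
pose X := bary v (c 0%N) (c 1%N) (0 + r * a) (0 + r * b).
pose Y := bary v (c j) (c j.+1) (0 + r * a') (0 + r * b').
have Xs : simplex (tri v (c 0%N) (c 1%N)) X by apply: bary_simplex; lra.
have Ys : simplex (tri v (c j) (c j.+1)) Y by apply: bary_simplex; lra.
have XY : X = Y.
  apply: Uinj.
  - by apply/mem_set; split; [exists (tri v (c 0%N) (c 1%N))|apply: D1; lra].
  - by apply/mem_set; split; [exists (tri v (c j) (c j.+1))|apply: D2; lra].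
  apply: (isom_inj fi); have [_ _ X1] := Xs; have [_ _ Y1] := Ys.
  rewrite !ext_isom // !ext_bary /= fv !subr0 !add0r !fc ?(ltnW jk) //.
  by rewrite -!(scalerA r) -!scalerDr e.
(* [Y] has positive weight at [c j] and [c j.+1], while [X] lives on triangle [0]. This forces
   [j = 1] and [c 2] among [c 0], [c 1], impossible since [2 < k]. *)
have cj : c j \in tri v (c 0%N) (c 1%N).
  apply: (simplex_gt0 Xs); rewrite XY baryE eqxx.
  have [vj _ jj] := fan_neq T3 cF jk; rewrite eq_sym (negPf vj) (negPf jj) /=.
  by rewrite !mulr0 mulr1 add0r addr0 add0r.
have cj1 : c j.+1 \in tri v (c 0%N) (c 1%N).
  apply: (simplex_gt0 Xs); rewrite XY baryE eqxx.
  have [_ vj jj] := fan_neq T3 cF jk; rewrite ![c j.+1 == _]eq_sym (negPf vj) (negPf jj) /=.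
  by rewrite !mulr0 mulr1 add0r add0r add0r.
have ne m : (m <= k)%N -> (c m == v) = false.
  by move=> mk; have := fan_neqv T3 cF mk; rewrite eq_sym => /negPf.
have k1 : (1 < k)%N by exact: ltnW.
move: cj; rewrite !inE ne ?(ltnW jk) //= => /orP[]/eqP E.
  by have := ci _ _ jk k0 E => Ej; rewrite Ej in j0.
have Ej : j = 1%N by exact: ci.
move: cj1; rewrite Ej !inE ne //= => /orP[]/eqP E2.
  by have := ci _ _ k2 k0 E2.
by have := ci _ _ k2 k1 E2.
Qed.

End Development.

(** * From placements back to developments *)

Section Realize.
Variables (R : realType) (n : nat) (T : {set {set 'I_n}}) (l : {set 'I_n} -> R).
Implicit Types (t e : {set 'I_n}) (a b p q u v : 'I_n)
  (P Q : 'I_n -> 'rV[R]_2) (x y z : 'rV[R]_n).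

Local Notation tri a b c := [set a; b; c]%SET.
Local Notation pair a b := [set a; b]%SET.

Hypotheses (T_disk : triangulated_disk R T)
  (l_gt0 : forall e : {set 'I_n}, e \in edges T -> 0 < l e).

Let T3 : forall t, t \in T -> #|t| = 3.
Proof. by have [[]] := T_disk. Qed.

Lemma flat_fan v : flat T l ->
  (exists k c, [/\ fan T v k c, c k = c 0 & fan_sum l v c k = 2 * pi]) \/
  (exists k c, fan T v k c /\ c k != c 0).
Proof.
move=> fl; have [[_ Tl] _] := T_disk.
case: (Tl v) => [[s sl]|[s /path_link_fan ?]]; last by right; do 2!eexists; eassumption.
left; have [cF ck _ _] := cyclic_link_fan sl; do 2!eexists; split; [exact: cF|exact: ck|].
have := fl v s (closed_fan_interior T3 cF ck) sl.
by rewrite (curvature_fan l sl) => /eqP; rewrite subr_eq0 => /eqP.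
Qed.

Lemma star_exists v : tri_ineq T l -> flat T l -> exists Q, placed (star T v) l Q.
Proof.
move=> ti fl.
have [k [c [cF cS]]] : exists k c, fan T v k c /\
    (c k = c 0 -> fan_sum l v c k = 2 * pi).
  have [[k [c [cF _ e]]]|[k [c [cF ne]]]] := flat_fan v fl; exists k, c; split=> //.
  by move=> e; rewrite e eqxx in ne.
pose w j : 'rV[R]_2 := l (pair v (c j)) *: expi (fan_sum l v c j).
(* Vertices outside the star get the irrelevant value [0]. In a closed fan [pick] may return either
   index, [0] or [k], of the same vertex; the total angle [2 pi] makes both positions agree. *)
pose Q p := if p == v then 0 else
  if [pick j : 'I_k.+1 | c j == p] is Some j then w j else 0.
exists Q; apply: (star_placed T3 l_gt0 cF ti) => [|j jk]; first by rewrite /Q eqxx.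
have vc := fan_neqv T3 cF jk; rewrite /Q eq_sym (negPf vc).
case: pickP => [j' /eqP e|/(_ (Ordinal (jk : (j < k.+1)%N)))]; last by rewrite eqxx.
have [ci ck _] := cF; have jk' : (j' <= k)%N by rewrite -ltnS.
have wrap m : (m < k)%N -> c m = c k -> w m = w k.
  move=> mk em; case: ck => [[k2 ck]|[_ /(_ m mk)]]; last by rewrite em eqxx.
  have -> : m = 0%N by apply: ci => //; [exact: fan_gt0 cF|rewrite em].
  by rewrite /w cS // fan_sum0 -(add0r (2 * pi)) expiD2pi ck.
suff : w j' = w j by [].
have last m : (m <= k)%N -> (k <= m)%N -> m = k by move=> mk km; apply/eqP; rewrite eqn_leq mk.
have [jk1|jk1] := ltnP j k; have [jk1'|jk1'] := ltnP j' k.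
- by rewrite (ci _ _ jk1' jk1 e).
- by rewrite (last _ jk' jk1') in e *; rewrite -(wrap j).
- by rewrite (last _ jk jk1) in e *; rewrite (wrap j').
- by rewrite (last _ jk jk1) (last _ jk' jk1').
Qed.

(** For [a != b], the images lie on opposite closed sides of the line through [P p] and [P q], so
    equal images have no component across it and both points are on the common edge. *)
Lemma edge_injective P p q a b y z : placed T l P -> tri p q a \in T -> tri p q b \in T ->
  simplex (tri p q a) y -> simplex (tri p q b) z -> ext P y = ext P z -> y = z.
Proof.
move=> [_ D2 D3] pqa pqb ya zb e.
have [ab|ab] := eqVneq a b.
  by rewrite -ab in zb; apply: (ext_inj_tri (T3 pqa) (D2 _ _ _ pqa) ya zb e).
have ey := ext_tri P (T3 pqa) ya; have ez := ext_tri P (T3 pqb) zb.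
have op := D3 _ _ _ _ pqa pqb ab.
have eab : y 0 a * area P p q a = z 0 b * area P p q b.
  have K (s r : R) (u w : 'rV[R]_2) : cross u (s *: u + r *: w) = r * cross u w.
    by rewrite /cross !mxE; ring.
  by rewrite /area -(K (y 0 q)) -(K (z 0 q)) -ey -ez e.
have [y0 yt y1] := ya; have [z0 zt z1] := zb.
have A2 : 0 < area P p q a ^+ 2.
  by rewrite lt_neqAle sqr_ge0 andbT eq_sym sqrf_eq0; apply: D2.
have ya0 : y 0 a = 0.
  apply/eqP; rewrite eq_le y0 andbT -(ler_pM2r A2) mul0r expr2 mulrA eab.
  by rewrite -mulrA [_ * area P p q a]mulrC mulr_ge0_le0 // ltW.
have zb0 : z 0 b = 0.
  move: eab; rewrite ya0 mul0r => /esym/eqP; rewrite mulf_eq0 => /orP[/eqP //|].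
  by rewrite (negPf (D2 _ _ _ pqb)).
apply: (@simplex_eq _ _ p) => // i ip.
have [->|iq] := eqVneq i q.
  move: ey; rewrite e ez ya0 zb0 !scale0r !addr0 => /eqP.
  rewrite -subr_eq0 -scalerBl scaler_eq0 subr_eq0 => /orP[/eqP //|/eqP qp0].
  by have := D2 _ _ _ pqa; rewrite /area qp0 /cross !mxE !mul0r subrr eqxx.
have -> : y 0 i = 0.
  have [->//|ia] := eqVneq i a; apply: yt.
  by rewrite !inE (negPf ip) (negPf iq) (negPf ia).
have [->//|ib] := eqVneq i b; apply/esym; apply: zt.
by rewrite !inE (negPf ip) (negPf iq) (negPf ib).
Qed.

(** The coordinates other than that of [v] are the weights on the rays of the fan; [fan_inj]
    compares them one at a time, with the indicator of [p] as test function. The coordinate at [v]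
    follows from the sum [1]. *)
Lemma star_injective P v k c y z : placed T l P -> fan T v k c -> c k = c 0 ->
  fan_sum l v c k = 2 * pi -> realization T y -> realization T z -> 0 < y 0 v -> 0 < z 0 v ->
  ext P y = ext P z -> y = z.
Proof.
move=> PP cF ck Sk [t tT yt] [t' t'T zt] yv zv e.
have ti := placed_tri_ineq T3 PP; have k0 := fan_gt0 cF.
have [f [fi fv fc]] := fan_placement T3 l_gt0 cF ti (placed_sub (star_sub T v) PP).
have rgt := fan_radius_gt0 T3 l_gt0 cF; have stp := fan_step T3 l_gt0 cF ti.
have [i ik tE] := fan_triP T3 cF tT (simplex_gt0 yt yv); rewrite {}tE in tT yt.
have [j jk tE] := fan_triP T3 cF t'T (simplex_gt0 zt zv); rewrite {}tE in t'T zt.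
have [y0 yo y1] := yt; have [z0 zo z1] := zt.
have fext m x : (m < k)%N -> tri v (c m) (c m.+1) \in T -> simplex (tri v (c m) (c m.+1)) x ->
    f (ext P x) = x 0 (c m) *: f (P (c m)) + x 0 (c m.+1) *: f (P (c m.+1)).
  move=> mk mT xt; have [_ _ x1] := xt; rewrite ext_isom //.
  by have := ext_tri (f \o P) (T3 mT) xt; rewrite /= fv !subr0.
have := congr1 f e; rewrite (fext i y) // (fext j z) // !fc ?(ltnW ik) ?(ltnW jk) // => e'.
have coord m x p : p != v -> (m < k)%N -> simplex (tri v (c m) (c m.+1)) x ->
    x 0 p = x 0 (c m) * (c m == p)%:R + x 0 (c m.+1) * (c m.+1 == p)%:R.
  move=> pv mk [_ xo _]; have [_ _ cc] := fan_neq T3 cF mk.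
  have [<-|mp] := eqVneq (c m) p.
    by rewrite eq_sym (negPf cc) mulr1 mulr0 addr0.
  have [<-|mp'] := eqVneq (c m.+1) p; first by rewrite mulr1 mulr0 add0r.
  by rewrite xo ?mulr0 ?addr0 // !inE (negPf pv) ![p == _]eq_sym (negPf mp) (negPf mp').
apply: (@simplex_eq _ _ v) => // p pv.
rewrite (coord i y p) // (coord j z p) //.
apply: (fan_inj rgt (fan_sum0 l v c) stp (F := fun m => (c m == p)%:R)) => //.
- by rewrite /= ck Sk fan_sum0 -(add0r (2 * pi)) expiD2pi.
- by rewrite ck.
Qed.

Lemma nbhs_gt0 x p : 0 < x 0 p -> nbhs x [set y : 'rV[R]_n | 0 < y 0 p]%classic.
Proof.
move=> xp; apply: (nbhs_normP x _).2; exists (x 0 p) => // y /= xy.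
have := le_lt_trans (coord_le_norm _ p) xy; rewrite !mxE.
by rewrite ltr_norml => /andP[_]; lra.
Qed.

(** The neighbourhoods are open stars, cut out by positivity of coordinates. If [x] has two positive
    coordinates, every triangle met there contains the edge [p q]; otherwise [x] is a vertex and the
    whole fan around it is needed. *)
Lemma placed_locally_injective P : placed T l P -> flat T l -> locally_injective T P.
Proof.
move=> PP fl x [[t tT xt] xb]; have [x0 xo x1] := xt.
have [[p [q [pq xp xq]]]|one] := pselect (exists p q, [/\ p != q, 0 < x 0 p & 0 < x 0 q]).
  exists ([set y | 0 < y 0 p] `&` [set y | 0 < y 0 q])%classic.
    by apply: filterI; exact: nbhs_gt0.
  move=> y z /set_mem[[t1 t1T yt] [yp yq]] /set_mem[[t2 t2T zt] [zp zq]].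
  have third t' y' : t' \in T -> simplex t' y' -> 0 < y' 0 p -> 0 < y' 0 q ->
      exists a, t' = tri p q a.
    move=> t'T yt' y'p y'q; have pt := simplex_gt0 yt' y'p; have qt := simplex_gt0 yt' y'q.
    have [a [b tE]] := triP (T3 t'T) pt; move: qt; rewrite tE !inE eq_sym (negPf pq) /=.
    by move=> /orP[]/eqP ->; [exists b|exists a; rewrite triAC].
  have [a ta] := third _ _ t1T yt yp yq; have [b tb] := third _ _ t2T zt zp zq.
  by rewrite ta in t1T yt; rewrite tb in t2T zt; apply: edge_injective t1T t2T yt zt.
have [v xv] : exists v, 0 < x 0 v.
  apply: contrapT => no; have : \sum_i x 0 i = 0.
    apply: big1 => i _; apply/eqP; rewrite eq_le x0 andbT leNgt.
    by apply/negP => xi; apply: no; exists i.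
  by rewrite x1 => /eqP; rewrite oner_eq0.
have x_v p : p != v -> x 0 p = 0.
  move=> pv; apply/eqP; rewrite eq_le x0 andbT leNgt; apply/negP => xp.
  by apply: one; exists p, v.
(* An open fan would put the vertex [x] on a boundary edge, so the fan is closed. *)
have [[k [c [cF ck Sk]]]|[k [c [cF ck]]]] := flat_fan v fl.
  exists [set y : 'rV[R]_n | 0 < y 0 v]%classic; first exact: nbhs_gt0.
  by move=> y z /set_mem[yr yv] /set_mem[zr zv]; exact: star_injective cF ck Sk _ _ yv zv.
have [e eB ve] := open_fan_boundary T3 cF ck.
case: xb; exists e => //; split=> // p pe; apply: x_v.
by apply: contraNneq pe => ->.
Qed.

Lemma placed_development P : placed T l P -> flat T l -> nondegenerate_development T l (ext P).
Proof.
move=> PP fl; have [D1 D2 _] := PP; split.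
- exact: ext_continuous.
- move=> t tT; split.
    by move=> x y s _ _ _; rewrite extD !extZ.
  have [a [b [c tE]]] := tri_of T_disk tT; rewrite tE in tT *.
  move=> x y /set_mem xt /set_mem yt.
  exact: (ext_inj_tri (T3 tT) (D2 _ _ _ tT) xt yt).
- exact: placed_locally_injective.
move=> i j; rewrite inE cards2 => /andP[ij /existsP[t /andP[tT]]].
rewrite finset.subUset !finset.sub1set => /andP[it jt].
by rewrite !ext_vertex; apply: D1 tT it jt _; case: (i != j) ij.
Qed.

End Realize.

Theorem theorem1 (R : realType) (n : nat) (T : {set {set 'I_n}})
    (l : {set 'I_n} -> R)
    (T_disk : triangulated_disk R T)
    (l_gt0 : forall e : {set 'I_n}, e \in edges T -> 0 < l e) :
  ((exists phi : 'rV[R]_n -> 'rV[R]_2, nondegenerate_development T l phi) <->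
   ((forall i j k : 'I_n, [set i; j; k]%SET \in T ->
       l [set i; k]%SET < l [set i; j]%SET + l [set j; k]%SET) /\
    (forall (v : 'I_n) (c : seq 'I_n), interior_vertex T v -> cyclic_link T v c ->
       curvature l v c = 0)))
  /\
  (forall phi psi : 'rV[R]_n -> 'rV[R]_2,
     nondegenerate_development T l phi -> nondegenerate_development T l psi ->
     congruent_on (realization T) phi psi).
Proof.
split; first split.
- move=> [phi /(development_placed T_disk)[PP inj]]; split.
    by apply: placed_tri_ineq PP; case: T_disk => -[].
  exact: placed_flat PP inj.
- move=> [ti fl]; have [P PP] : exists P : 'I_n -> 'rV[R]_2, placed T l P.
    by apply: placed_exists => // v; exact: star_exists.
  by exists (ext P); exact: placed_development.
move=> phi psi phiD psiD.
have [PP _] := development_placed T_disk phiD.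
have [QP _] := development_placed T_disk psiD.
have [f fi fE] := placed_uniq T_disk l_gt0 PP QP.
have [M [b [MM fM]]] := fi; exists M, b; split=> // x xr.
rewrite -fM (development_ext phiD xr) (development_ext psiD xr).
rewrite ext_isom //; last by have [t _ []] := xr.
by congr (ext _ x); apply/funext => i; rewrite /= fE.
Qed.
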